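(* Let $H$ be a quantum Hadamard matrix over a finite quantum space $X$ and let $\mathfrak{H}=(Y,A)$, $\mathfrak{H}_0=(Y,A_0)$ be the corresponding quantum Hadamard graphs. Then $\mathrm{Aut}^+H$ acts on both $\mathfrak{H}$ and $\mathfrak{H}_0$. Moreover, $\mathrm{Aut}^+\mathfrak{H}_0=\mathrm{Aut}^+H$ (as compact quantum groups, via this action).
   Context: A finite quantum space $X$ is a special Frobenius $*$-algebra $C(X)$: a finite-dimensional unital $*$-algebra over $\mathbb{C}$ with multiplication $m$, unit map $\eta\colon\mathbb{C}\to C(X)$, and a positive functional $\psi$ such that $(a,b)\mapsto\psi(ab)$ is non-degenerate and $mm^\dagger=\mathrm{id}$, where $\dagger$ is the adjoint with respect to $\langle a,b\rangle=\psi(a^*b)$. Then $\psi=\eta^\dagger$. The resulting Hilbert space is $l^2(X)$; put $\delta^2:=\eta^\dagger\eta$ and $R:=m^\dagger\eta$, so $R^\dagger=\eta^\dagger m$. For $A,B\colon l^2(X)\to l^2(X)$ put $A^*:=(\mathrm{id}\otimes R^\dagger)(\mathrm{id}\otimes A^\dagger\otimes\mathrm{id})(R\otimes\mathrm{id})$ and $A\bullet B:=m(A\otimes B)m^\dagger$ (the latter also for maps with entries in a $*$-algebra). A quantum Hadamard matrix over $X$ is a linear map $H\colon l^2(X)\to l^2(X)$ with $H=H^*$, $H\bullet H=\eta\eta^\dagger$ and $HH^\dagger=\delta^2\,\mathrm{id}=H^\dagger H$. A unitary $u\in\mathscr{L}(l^2(X))\otimes\mathscr{A}$ ($\mathscr{A}$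 a unital $*$-algebra) is $X$-cubic if $(u\otimes u)R=R$ and $(u\otimes u)m^\dagger m=m^\dagger m(u\otimes u)$. $\mathscr{O}(\mathrm{Aut}^+H)$ is the universal $*$-algebra generated by the entries of $u$ such that $u$ and $HuH^{-1}$ are $X$-cubic, with $\Delta(u^i_j)=\sum_ku^i_k\otimes u^k_j$. Put $J=\eta\eta^\dagger$, $H^\pm=\frac12(J\pm H)$, $Y=X\sqcup X\sqcup X\sqcup X$, i.e. $C(Y)=C(X)^{\oplus 4}$ with functional the sum of the four copies of $\psi$; $m_Y$, $\eta_Y$ denote its structure maps. The quantum Hadamard graphs $\mathfrak{H}$, $\mathfrak{H}_0$ on $Y$ have adjacency matrices $$A=\begin{pmatrix} 0 & 0 & H^+ & H^- \\ 0 & 0 & H^- & H^+ \\ H^{+\dagger} & H^{-\dagger} & 0 & 0 \\ H^{-\dagger} & H^{+\dagger} & 0 & 0 \end{pmatrix},\qquad A_0=\begin{pmatrix} I & 0 & H^+ & H^- \\ 0 & I & H^- & H^+ \\ H^{+\dagger} & H^{-\dagger} & 0 & 0 \\ H^{-\dagger} & H^{+\dagger} & 0 & 0 \end{pmatrix}.$$ A quantum group $G$ acts on a quantum graph $(Y,A)$ if it has a unitary representation $u\in\mathscr{L}(l^2(Y))\otimes\mathscr{O}(G)$ (with $\Delta(u^i_j)=\sum_ku^i_k\otimes u^k_j$) satisfying $um_Y=m_Y(u\otimes u)$, $\eta_Y^\dagger u=\eta_Y^\dagger$, $uA=Au$. $\mathscr{O}(\mathrm{Aut}^+(Y,A))$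 is the universal $*$-algebra generated by the entries of a unitary $u$ with these three relations. The action of $\mathrm{Aut}^+H$ meant here goes via $$u=\begin{pmatrix} p^+ & p^- & 0 & 0 \\ p^- & p^+ & 0 & 0 \\ 0 & 0 & q^+ & q^- \\ 0 & 0 & q^- & q^+ \end{pmatrix},\quad p^\pm=\tfrac12(p\bullet p\pm p),\quad q^\pm=\tfrac12(q\bullet q\pm q),$$ where $q$ is the fundamental representation of $\mathrm{Aut}^+H$ and $p=HqH^{-1}$; the equality of quantum groups means that mapping the fundamental representation of $\mathrm{Aut}^+\mathfrak{H}_0$ to this $u$ gives a $*$-isomorphism $\mathscr{O}(\mathrm{Aut}^+\mathfrak{H}_0)\to\mathscr{O}(\mathrm{Aut}^+H)$. *)

(* Defs.v *)
From HB Require Import structures.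
From mathcomp Require Import all_boot all_order all_algebra.
From mathcomp Require Import boolp reals.
From mathcomp.real_closed Require Export complex mxtens.

Set Implicit Arguments.
Unset Strict Implicit.
Unset Printing Implicit Defensive.

Import Order.TTheory GRing.Theory Num.Theory.
Local Open Scope ring_scope.
Local Open Scope sesquilinear_scope.
Local Open Scope quotient_scope.

(* Unital *-algebras over C: a ring with a unital morphism from C to its center,
   so that c times x is [scal c * x]. The library's algType is not used because
   it excludes the zero ring, which universal *-algebras and tensor products are
   not known a priori to avoid. *)
HB.mixin Record PzRing_isStarAlgebra (C : numClosedFieldType) A
    of GRing.PzRing A := {
  scal : {rmorphism C -> A};
  star : A -> A;
  scalC : forall (c : C) (x : A), scal c * x = x * scal c;
  starK : involutive star;
  starD : {morph star : x y / x + y};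
  starM : forall x y : A, star (x * y) = star y * star x;
  star_scal : forall c : C, star (scal c) = scal (c^*)
}.

#[short(type="starAlgType")]
HB.structure Definition StarAlgebra (C : numClosedFieldType) :=
  {A of PzRing_isStarAlgebra C A & GRing.PzRing A}.

Arguments scal {C s} : rename.

HB.mixin Record RMorphism_isStarMorphism (C : numClosedFieldType)
    (A B : starAlgType C) (f : A -> B) of @GRing.RMorphism A B f := {
  hom_star : forall x, f (star x) = star (f x);
  hom_scal : forall c : C, f (scal c) = scal c
}.

#[short(type="starHom")]
HB.structure Definition StarHom (C : numClosedFieldType) (A B : starAlgType C) :=
  {f of RMorphism_isStarMorphism C A B f & @GRing.RMorphism A B f}.

Section Prod.
Variables (C : numClosedFieldType) (A B : starAlgType C).
Implicit Types x y : (A * B)%type.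

Definition pscal (c : C) : A * B := (scal c, scal c).
Definition pstar x : A * B := (star x.1, star x.2).

Fact pscal_additive : zmod_morphism pscal.
Proof. by move=> a b; rewrite /pscal !rmorphB. Qed.
Fact pscal_multiplicative : monoid_morphism pscal.
Proof. by split=> [|a b]; rewrite /pscal ?rmorph1 ?rmorphM. Qed.
HB.instance Definition _ := GRing.isZmodMorphism.Build C (A * B)%type pscal
  pscal_additive.
HB.instance Definition _ := GRing.isMonoidMorphism.Build C (A * B)%type pscal
  pscal_multiplicative.

Fact pscalC (c : C) x : pscal c * x = x * pscal c.
Proof. by congr pair; apply: scalC. Qed.
Fact pstarK : involutive pstar.
Proof. by case=> x y; rewrite /pstar !starK. Qed.
Fact pstarD : {morph pstar : x y / x + y}.
Proof. by move=> x y; congr pair; apply: starD. Qed.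
Fact pstarM x y : pstar (x * y) = pstar y * pstar x.
Proof. by congr pair; apply: starM. Qed.
Fact pstar_scal (c : C) : pstar (pscal c) = pscal c^*.
Proof. by congr pair; apply: star_scal. Qed.

HB.instance Definition _ := PzRing_isStarAlgebra.Build C (A * B)%type
  pscalC pstarK pstarD pstarM pstar_scal.
End Prod.

Lemma star0 (C : numClosedFieldType) (A : starAlgType C) : star (0 : A) = 0.
Proof. by apply: (@addrI _ (star 0)); rewrite -starD !addr0. Qed.

Lemma star_sum (C : numClosedFieldType) (A : starAlgType C) (I : Type)
    (r : seq I) (F : I -> A) : star (\sum_(i <- r) F i) = \sum_(i <- r) star (F i).
Proof. by apply: (big_morph star (@starD C A) (star0 A)). Qed.

(* Universal *-algebras. [P] is the list of relations, seen as a predicate on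
   families of elements of arbitrary *-algebras; [ualg P] is the quotient of the
   free *-algebra (terms) by the common kernel of all evaluations at families
   satisfying [P]. When [P] is a system of *-polynomial equations (as are all
   instances below), the generators [ugen] themselves satisfy [P], and
   [ualg P] is the *-algebra with this presentation: see [uev] and [ualg_ext]. *)
Inductive sterm (C G : Type) : Type :=
  | SGen of G
  | SScal of C
  | SAdd of sterm C G & sterm C G
  | SMul of sterm C G & sterm C G
  | SStar of sterm C G.

HB.instance Definition _ (C G : Type) := gen_eqMixin (sterm C G).
HB.instance Definition _ (C G : Type) := gen_choiceMixin (sterm C G).

Fixpoint seval (C : numClosedFieldType) (G : Type) (B : starAlgType C)
    (f : G -> B) (t : sterm C G) : B :=
  match t with
  | SGen g => f g
  | SScal c => scal c
  | SAdd s t => seval f s + seval f t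
  | SMul s t => seval f s * seval f t
  | SStar s => star (seval f s)
  end.

Section Universal.
Variables (C : numClosedFieldType) (G : Type).
Variable P : forall B : starAlgType C, (G -> B) -> Prop.
Local Notation term := (sterm C G).

Definition urel : rel term := fun s t =>
  `[< forall (B : starAlgType C) (f : G -> B), P f -> seval f s = seval f t >].

Fact urel_refl : reflexive urel.
Proof. by move=> s; apply/asboolP. Qed.
Fact urel_sym : symmetric urel.
Proof.
by move=> s t; apply/asboolP/asboolP => h B f Pf; rewrite (h B f Pf).
Qed.
Fact urel_trans : transitive urel.
Proof.
move=> s t u /asboolP h /asboolP k; apply/asboolP => B f Pf.
by rewrite (h B f Pf) (k B f Pf).
Qed.
Canonical urel_equiv := EquivRel urel urel_refl urel_sym urel_trans.

Definition ualg := {eq_quot urel}.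
HB.instance Definition _ := Choice.on ualg.
HB.instance Definition _ := Quotient.on ualg.

Definition ugen (g : G) : ualg := \pi_ualg (SGen C g).

Definition uev_fun (B : starAlgType C) (f : G -> B) (Pf : P f) (x : ualg) : B :=
  seval f (repr x).

Fact uev_pi (B : starAlgType C) (f : G -> B) (Pf : P f) t : uev_fun Pf (\pi_ualg t) = seval f t.
Proof.
rewrite /uev_fun; case: piP => s /eqmodP /asboolP h.
by rewrite (h B f Pf).
Qed.

Fact uev_inj x y :
  (forall (B : starAlgType C) (f : G -> B) (Pf : P f), uev_fun Pf x = uev_fun Pf y) -> x = y.
Proof.
move=> h; rewrite -[x]reprK -[y]reprK; apply/eqmodP/asboolP => B f Pf.
exact: (h B f Pf).
Qed.

Definition uscal (c : C) : ualg := \pi_ualg (SScal G c).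
Definition uadd (x y : ualg) : ualg := \pi_ualg (SAdd (repr x) (repr y)).
Definition umul (x y : ualg) : ualg := \pi_ualg (SMul (repr x) (repr y)).
Definition uopp (x : ualg) : ualg := umul (uscal (-1)) x.
Definition ustar (x : ualg) : ualg := \pi_ualg (SStar (repr x)).

Section Ev.
Variables (B : starAlgType C) (f : G -> B) (Pf : P f).
Fact uevS c : uev_fun Pf (uscal c) = scal c. Proof. exact: uev_pi. Qed.
Fact uevD x y : uev_fun Pf (uadd x y) = uev_fun Pf x + uev_fun Pf y.
Proof. exact: uev_pi. Qed.
Fact uevM x y : uev_fun Pf (umul x y) = uev_fun Pf x * uev_fun Pf y.
Proof. exact: uev_pi. Qed.
Fact uevN x : uev_fun Pf (uopp x) = - uev_fun Pf x.
Proof. by rewrite uevM uevS rmorphN1 mulN1r. Qed.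
Fact uevStar x : uev_fun Pf (ustar x) = star (uev_fun Pf x).
Proof. exact: uev_pi. Qed.
Definition uevE := (uevN, uevS, uevD, uevM, uevStar, rmorph0, rmorph1).
End Ev.

Local Ltac uauto :=
  repeat intro; apply: uev_inj => B f Pf; rewrite !uevE.

Fact uaddA : associative uadd. Proof. by uauto; rewrite addrA. Qed.
Fact uaddC : commutative uadd. Proof. by uauto; rewrite addrC. Qed.
Fact uadd0 : left_id (uscal 0) uadd. Proof. by uauto; rewrite add0r. Qed.
Fact uaddN : left_inverse (uscal 0) uopp uadd.
Proof. by uauto; rewrite addNr. Qed.
HB.instance Definition _ := GRing.isZmodule.Build ualg uaddA uaddC uadd0 uaddN.

Fact umulA : associative umul. Proof. by uauto; rewrite mulrA. Qed.
Fact umul1 : left_id (uscal 1) umul. Proof. by uauto; rewrite mul1r. Qed.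
Fact umul1r : right_id (uscal 1) umul. Proof. by uauto; rewrite mulr1. Qed.
Fact umulDl : left_distributive umul (@GRing.add ualg).
Proof. by uauto; rewrite mulrDl. Qed.
Fact umulDr : right_distributive umul (@GRing.add ualg).
Proof. by uauto; rewrite mulrDr. Qed.
HB.instance Definition _ := GRing.Zmodule_isPzRing.Build ualg
  umulA umul1 umul1r umulDl umulDr.

Fact uscal_additive : zmod_morphism uscal.
Proof. by move=> a b; uauto; rewrite rmorphB. Qed.
Fact uscal_multiplicative : monoid_morphism uscal.
Proof. by split=> // a b; uauto; rewrite rmorphM. Qed.
HB.instance Definition _ := GRing.isZmodMorphism.Build C ualg uscal
  uscal_additive.
HB.instance Definition _ := GRing.isMonoidMorphism.Build C ualg uscal
  uscal_multiplicative.

Fact uscalC (c : C) (x : ualg) : uscal c * x = x * uscal c.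
Proof. by uauto; rewrite scalC. Qed.
Fact ustarK : involutive ustar. Proof. by move=> x; uauto; rewrite starK. Qed.
Fact ustarD : {morph ustar : x y / x + y}.
Proof. by move=> x y; uauto; rewrite starD. Qed.
Fact ustarM (x y : ualg) : ustar (x * y) = ustar y * ustar x.
Proof. by uauto; rewrite starM. Qed.
Fact ustar_scal (c : C) : ustar (uscal c) = uscal c^*.
Proof. by uauto; rewrite star_scal. Qed.
HB.instance Definition _ := PzRing_isStarAlgebra.Build C ualg
  uscalC ustarK ustarD ustarM ustar_scal.

Section EvHom.
Variables (B : starAlgType C) (f : G -> B) (Pf : P f).
Definition uev : ualg -> B := uev_fun Pf.

Fact uev_additive : zmod_morphism uev.
Proof. by move=> x y; rewrite /uev uevD uevN. Qed.
Fact uev_multiplicative : monoid_morphism uev.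
Proof. by split=> [|x y]; rewrite /uev ?uevS ?rmorph1 ?uevM. Qed.
HB.instance Definition _ := GRing.isZmodMorphism.Build ualg B uev uev_additive.
HB.instance Definition _ := GRing.isMonoidMorphism.Build ualg B uev
  uev_multiplicative.
Fact uev_star x : uev (star x) = star (uev x). Proof. exact: uevStar. Qed.
Fact uev_scal c : uev (scal c) = scal c. Proof. exact: uevS. Qed.
HB.instance Definition _ := RMorphism_isStarMorphism.Build C ualg B uev
  uev_star uev_scal.

Lemma uev_ugen g : uev (ugen g) = f g. Proof. exact: uev_pi. Qed.
End EvHom.

Lemma ualg_ext (x y : ualg) :
  (forall (B : starAlgType C) (f : G -> B) (Pf : P f), uev Pf x = uev Pf y) -> x = y.
Proof. exact: uev_inj. Qed.

Lemma ualg_hom_ext (B : starAlgType C) (f g : starHom ualg B) :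
  (forall i, f (ugen i) = g (ugen i)) -> f =1 g.
Proof.
move=> fg x; rewrite -[x]reprK; elim: (repr x) => {x} [i|c|s IHs t IHt|s IHs t IHt|s IHs].
- exact: fg.
- by rewrite -[\pi _]/(scal c : ualg) !hom_scal.
- have -> : \pi_ualg (SAdd s t) = \pi_ualg s + \pi_ualg t :> ualg.
    by apply: uev_inj => D h Ph; rewrite uevD !uev_pi.
  by rewrite !rmorphD /= IHs IHt.
- have -> : \pi_ualg (SMul s t) = \pi_ualg s * \pi_ualg t :> ualg.
    by apply: uev_inj => D h Ph; rewrite uevM !uev_pi.
  by rewrite !rmorphM /= IHs IHt.
- have -> : \pi_ualg (SStar s) = star (\pi_ualg s) :> ualg.
    by apply: uev_inj => D h Ph; rewrite uevStar !uev_pi.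
  by rewrite !hom_star IHs.
Qed.
End Universal.

(* The algebraic tensor product, as the *-algebra generated by commuting copies
   of its two factors; x (x) y is [tensl x * tensr y]. *)
Section Tensor.
Variables (C : numClosedFieldType) (A B : starAlgType C).

Definition is_star_hom (D E : starAlgType C) (f : D -> E) : Prop :=
  [/\ zmod_morphism f, monoid_morphism f, forall x, f (star x) = star (f x)
    & forall c : C, f (scal c) = scal c].

Definition tens_rel (D : starAlgType C) (f : A + B -> D) : Prop :=
  [/\ is_star_hom (f \o inl), is_star_hom (f \o inr)
    & forall x y, GRing.comm (f (inl x)) (f (inr y))].

Definition tensalg := ualg tens_rel.
HB.instance Definition _ := StarAlgebra.on tensalg.

Definition tensl (x : A) : tensalg := ugen tens_rel (inl x).
Definition tensr (y : B) : tensalg := ugen tens_rel (inr y).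

Lemma tens_comm x y : GRing.comm (tensl x) (tensr y).
Proof.
apply: ualg_ext => D f Pf; rewrite !rmorphM /= !uev_ugen.
by case: Pf => _ _; apply.
Qed.

Fact tensl_additive : zmod_morphism tensl.
Proof.
move=> x y; apply: ualg_ext => D f Pf; rewrite rmorphB /= !uev_ugen.
by case: Pf => -[h _ _ _] _ _; apply: h.
Qed.
Fact tensl_multiplicative : monoid_morphism tensl.
Proof.
split=> [|x y]; apply: ualg_ext => D f Pf.
  by rewrite rmorph1 uev_ugen; case: Pf => -[_ [h _] _ _] _ _; apply: h.
by rewrite rmorphM /= !uev_ugen; case: Pf => -[_ [_ h] _ _] _ _; apply: h.
Qed.
HB.instance Definition _ := GRing.isZmodMorphism.Build A tensalg tensl
  tensl_additive.
HB.instance Definition _ := GRing.isMonoidMorphism.Build A tensalg tensl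
  tensl_multiplicative.
Fact tensl_star x : tensl (star x) = star (tensl x).
Proof.
apply: ualg_ext => D f Pf; rewrite hom_star /= !uev_ugen.
by case: Pf => -[_ _ h _] _ _; apply: h.
Qed.
Fact tensl_scal c : tensl (scal c) = scal c.
Proof.
apply: ualg_ext => D f Pf; rewrite hom_scal /= !uev_ugen.
by case: Pf => -[_ _ _ h] _ _; apply: h.
Qed.
HB.instance Definition _ := RMorphism_isStarMorphism.Build C A tensalg tensl
  tensl_star tensl_scal.

Fact tensr_additive : zmod_morphism tensr.
Proof.
move=> x y; apply: ualg_ext => D f Pf; rewrite rmorphB /= !uev_ugen.
by case: Pf => _ [h _ _ _] _; apply: h.
Qed.
Fact tensr_multiplicative : monoid_morphism tensr.
Proof.
split=> [|x y]; apply: ualg_ext => D f Pf.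
  by rewrite rmorph1 uev_ugen; case: Pf => _ [_ [h _] _ _] _; apply: h.
by rewrite rmorphM /= !uev_ugen; case: Pf => _ [_ [_ h] _ _] _; apply: h.
Qed.
HB.instance Definition _ := GRing.isZmodMorphism.Build B tensalg tensr
  tensr_additive.
HB.instance Definition _ := GRing.isMonoidMorphism.Build B tensalg tensr
  tensr_multiplicative.
Fact tensr_star x : tensr (star x) = star (tensr x).
Proof.
apply: ualg_ext => D f Pf; rewrite hom_star /= !uev_ugen.
by case: Pf => _ [_ _ h _] _; apply: h.
Qed.
Fact tensr_scal c : tensr (scal c) = scal c.
Proof.
apply: ualg_ext => D f Pf; rewrite hom_scal /= !uev_ugen.
by case: Pf => _ [_ _ _ h] _; apply: h.
Qed.
HB.instance Definition _ := RMorphism_isStarMorphism.Build C B tensalg tensr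
  tensr_star tensr_scal.
End Tensor.

Lemma is_star_homP (C : numClosedFieldType) (A B : starAlgType C)
  (f : starHom A B) : is_star_hom f.
Proof.
split; [exact: rmorphB | | exact: hom_star | exact: hom_scal].
by split; [exact: rmorph1 | exact: rmorphM].
Qed.

Section CompHom.
Variables (C : numClosedFieldType) (A B D : starAlgType C).
Variables (f : starHom B D) (g : starHom A B).
Fact comp_hom_star x : (f \o g) (star x) = star ((f \o g) x).
Proof. by rewrite /= !hom_star. Qed.
Fact comp_hom_scal c : (f \o g) (scal c) = scal c.
Proof. by rewrite /= !hom_scal. Qed.
HB.instance Definition _ := RMorphism_isStarMorphism.Build C A D (f \o g)
  comp_hom_star comp_hom_scal.
End CompHom.

Section TensorHom.
Variables (C : numClosedFieldType) (A A' B B' : starAlgType C).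
Variables (f : starHom A A') (g : starHom B B').

Definition tenshom_gen (x : A + B) : tensalg A' B' :=
  match x with inl a => tensl B' (f a) | inr b => tensr A' (g b) end.

Fact tenshom_rel : tens_rel tenshom_gen.
Proof.
split; last by move=> x y; apply: tens_comm.
- exact: (is_star_homP (@tensl _ A' B' \o f)).
- exact: (is_star_homP (@tensr _ A' B' \o g)).
Qed.

Definition tenshom : starHom (tensalg A B) (tensalg A' B') := uev tenshom_rel.
End TensorHom.

(* The *-algebra generated by the n^2 entries of a matrix subject to the
   relation P. *)
Section MatrixRel.
Variables (C : numClosedFieldType) (n : nat).
Variable P : forall B : starAlgType C, 'M[B]_n -> Prop.

Definition mxrel (B : starAlgType C) (f : 'I_n * 'I_n -> B) : Prop :=
  P (\matrix_(i, j) f (i, j)).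
Definition mxalg := ualg mxrel.
HB.instance Definition _ := StarAlgebra.on mxalg.

Definition mxgen : 'M[mxalg]_n := \matrix_(i, j) ugen mxrel (i, j).

Fact mxrelP (B : starAlgType C) (u : 'M[B]_n) :
  P u -> mxrel (fun ij => u ij.1 ij.2).
Proof.
by rewrite /mxrel; set v := \matrix_(_, _) _; suff -> : v = u by [];
  apply/matrixP => i j; rewrite mxE.
Qed.

Definition mxlift (B : starAlgType C) (u : 'M[B]_n) (Pu : P u) :
  starHom mxalg B := uev (mxrelP Pu).

Lemma mxliftE (B : starAlgType C) (u : 'M[B]_n) (Pu : P u) :
  map_mx (mxlift Pu) mxgen = u.
Proof. by apply/matrixP => i j; rewrite !mxE /= uev_ugen. Qed.

Lemma mxalg_ext m k (M N : 'M[mxalg]_(m, k)) :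
  (forall (B : starAlgType C) (u : 'M[B]_n) (Pu : P u),
     map_mx (mxlift Pu) M = map_mx (mxlift Pu) N) -> M = N.
Proof.
move=> h; apply/matrixP => i j; apply: ualg_ext => B f Pf.
have /matrixP/(_ i j) := h B _ Pf; rewrite !mxE /=.
set k1 := mxlift Pf; set k2 := uev Pf.
suff k12 : k1 =1 k2 by rewrite !k12.
by apply: ualg_hom_ext => -[a b]; rewrite /= !uev_ugen mxE.
Qed.
End MatrixRel.

(* The part of the structure of a compact quantum group G that is needed to speak
   of its representations and of isomorphisms: O(G) with its comultiplication. *)
Record qgroup (C : numClosedFieldType) := QGroup {
  qgroup_alg :> starAlgType C;
  comult : starHom qgroup_alg (tensalg qgroup_alg qgroup_alg)
}.

Definition qgroup_iso (C : numClosedFieldType) (G K : qgroup C)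
    (f : starHom G K) : Prop :=
  bijective f /\ (forall x, comult K (f x) = tenshom f f (comult G x)).

(* Delta(u^i_j) = \sum_k u^i_k (x) u^k_j *)
Definition corep (C : numClosedFieldType) (G : qgroup C) n (u : 'M[G]_n) : Prop :=
  map_mx (comult G) u = map_mx (@tensl C G G) u *m map_mx (@tensr C G G) u.

(* The quantum group whose function algebra is generated by the entries of a
   matrix subject to P, when P is stable under products of commuting solutions. *)
Section MatrixQGroup.
Variables (C : numClosedFieldType) (n : nat).
Variable P : forall B : starAlgType C, 'M[B]_n -> Prop.

Definition mxrel_gen : Prop := P (mxgen P).
Definition mxrel_hom : Prop :=
  forall (A B : starAlgType C) (f : starHom A B) (u : 'M[A]_n),
    P u -> P (map_mx f u).
Definition mxrel_mul : Prop :=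
  forall (A : starAlgType C) (u v : 'M[A]_n),
    (forall i j k l, GRing.comm (u i j) (v k l)) ->
    P u -> P v -> P (u *m v).

Hypotheses (Pgen : mxrel_gen) (Phom : mxrel_hom) (Pmul : mxrel_mul).

Local Notation O := (mxalg P).

Fact comult_rel :
  P (map_mx (@tensl C O O) (mxgen P) *m map_mx (@tensr C O O) (mxgen P)).
Proof.
apply: Pmul; [|exact: Phom|exact: Phom].
by move=> i j k l; rewrite !mxE; apply: tens_comm.
Qed.

Definition mxqgroup : qgroup C := @QGroup C O (mxlift comult_rel).

Lemma mxqgroup_corep : corep (mxgen P : 'M[mxqgroup]_n).
Proof. exact: mxliftE. Qed.
End MatrixQGroup.

Section MatrixLemmas.
Variables (C : numClosedFieldType).

(* The embedding of L(l^2(X)) into L(l^2(X)) (x) A. *)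
Definition liftmx (A : starAlgType C) m n (M : 'M[C]_(m, n)) : 'M[A]_(m, n) :=
  map_mx (@scal C A) M.

Definition starmx (A : starAlgType C) m n (u : 'M[A]_(m, n)) : 'M[A]_(n, m) :=
  map_mx star u^T.

Definition unitary (A : starAlgType C) n (u : 'M[A]_n) : Prop :=
  u *m starmx u = 1%:M /\ starmx u *m u = 1%:M.

Section Alg.
Variable A : starAlgType C.

Lemma liftmxM m n p (M : 'M[C]_(m, n)) (N : 'M[C]_(n, p)) :
  liftmx A (M *m N) = liftmx A M *m liftmx A N.
Proof. exact: map_mxM. Qed.

Lemma liftmx1 n : liftmx A (1%:M : 'M[C]_n) = 1%:M.
Proof. exact: map_mx1. Qed.

Lemma starmxM m n p (u : 'M[A]_(m, n)) (v : 'M[A]_(n, p)) :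
  starmx (u *m v) = starmx v *m starmx u.
Proof.
apply/matrixP => i j; rewrite !mxE star_sum; apply: eq_bigr => k _.
by rewrite !mxE starM.
Qed.

Lemma tensmx_mul_comm m n p q r s (a : 'M[A]_(m, n)) (b : 'M[A]_(p, q))
    (c : 'M[A]_(n, r)) (d : 'M[A]_(q, s)) :
  (forall i j k l, GRing.comm (b i j) (c k l)) ->
  (a *m c) *t (b *m d) = (a *t b) *m (c *t d).
Proof.
move=> bc; apply/matrixP => i j; rewrite !mxE mulr_sum.
apply: eq_bigr => k _; rewrite !mxE -!mulrA; congr (_ * _).
by rewrite !mulrA; congr (_ * _); rewrite -bc.
Qed.

Lemma liftmx_comm m n p q (M : 'M[C]_(m, n)) (u : 'M[A]_(p, q)) i j k l :
  GRing.comm (liftmx A M i j) (u k l).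
Proof. by rewrite /GRing.comm mxE scalC. Qed.

Lemma mulmx_comm m n p q r (u : 'M[A]_(m, n)) (v : 'M[A]_(n, p))
    (w : 'M[A]_(q, r)) :
  (forall i j k l, GRing.comm (u i j) (w k l)) ->
  (forall i j k l, GRing.comm (v i j) (w k l)) ->
  forall i j k l, GRing.comm ((u *m v) i j) (w k l).
Proof.
move=> uw vw i j k l; rewrite mxE; apply/commr_sym/commr_sum => a _.
by apply: commrM; apply/commr_sym.
Qed.

Lemma unitaryM n (u v : 'M[A]_n) : unitary u -> unitary v -> unitary (u *m v).
Proof.
move=> [u1 u2] [v1 v2]; split; rewrite starmxM.
  by rewrite mulmxA -(mulmxA u) v1 mulmx1.
by rewrite mulmxA -(mulmxA (starmx v)) u2 mulmx1.
Qed.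
End Alg.

Section Hom.
Variables (A B : starAlgType C) (f : starHom A B).

Lemma map_liftmx m n (M : 'M[C]_(m, n)) : map_mx f (liftmx A M) = liftmx B M.
Proof. by apply/matrixP => i j; rewrite !mxE hom_scal. Qed.

Lemma map_starmx m n (u : 'M[A]_(m, n)) :
  map_mx f (starmx u) = starmx (map_mx f u).
Proof. by apply/matrixP => i j; rewrite !mxE hom_star. Qed.

Lemma map_mx1h n : map_mx f (1%:M : 'M[A]_n) = 1%:M.
Proof. exact: map_mx1. Qed.

Definition map_mxh := (map_liftmx, map_starmx, map_mx1h, map_mxM f, map_mxT f).

Lemma unitary_hom n (u : 'M[A]_n) : unitary u -> unitary (map_mx f u).
Proof. by case=> u1 u2; split; rewrite -!map_mxh ?u1 ?u2. Qed.
End Hom.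
End MatrixLemmas.

(* Structure maps of a *-algebra with functional in the basis e, which will be
   orthonormal for <a, b> = psi(a^* b): the (i, j (x) k) entry of the
   multiplication is <e_i, e_j e_k> and the i-th coordinate of the unit is
   <e_i, 1>. *)
Definition mult_mx (C : numClosedFieldType) (A : starAlgType C) (psi : A -> C) n
    (e : 'I_n -> A) : 'M[C]_(n, n * n) :=
  \matrix_(i, jk) psi (star (e i) *
                       (e (mxtens_unindex jk).1 * e (mxtens_unindex jk).2)).

Definition one_mx (C : numClosedFieldType) (A : starAlgType C) (psi : A -> C) n
    (e : 'I_n -> A) : 'cV[C]_n := \col_i psi (star (e i) * 1).

(* Finite quantum spaces X, with a chosen orthonormal basis [qonb] identifying
   l^2(X) with C^(qdim X) (it also makes C(X) finite-dimensional). The tensor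
   product basis identifies l^2(X) (x) l^2(X) with C^(qdim X * qdim X), and the
   adjoint of a linear map is the conjugate transpose of its matrix. *)
Record qspace (C : numClosedFieldType) := QSpace {
  qfun : starAlgType C;
  qpsi : {additive qfun -> C};
  qdim : nat;
  qonb : 'I_qdim -> qfun;
  qpsi_scal : forall (c : C) (a : qfun), qpsi (scal c * a) = c * qpsi a;
  qpsi_ge0 : forall a, 0 <= qpsi (star a * a);
  qpsi_nondegl : forall a, (forall b, qpsi (a * b) = 0) -> a = 0;
  qpsi_nondegr : forall b, (forall a, qpsi (a * b) = 0) -> b = 0;
  qonb_orth : forall i j, qpsi (star (qonb i) * qonb j) = (i == j)%:R;
  qonb_span : forall a, a = \sum_i scal (qpsi (star (qonb i) * a)) * qonb i;
  qspecial : mult_mx qpsi qonb *m (mult_mx qpsi qonb)^t* = 1%:M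
}.

Lemma sum_tens (V : nmodType) p q (F : 'I_(p * q) -> V) :
  \sum_k F k = \sum_i \sum_j F (mxtens_index (i, j)).
Proof.
rewrite pair_bigA (reindex (@mxtens_index p q)) /=.
  by apply: eq_bigr => -[].
by exists (@mxtens_unindex p q) => k _; rewrite (mxtens_indexK, mxtens_unindexK).
Qed.

Section QSpace.
Variables (C : numClosedFieldType) (X : qspace C).
Local Notation n := (qdim X).

Definition qm : 'M[C]_(n, n * n) := mult_mx (@qpsi C X) (@qonb C X).
Definition qeta : 'cV[C]_n := one_mx (@qpsi C X) (@qonb C X).
Definition qR : 'cV[C]_(n * n) := qm^t* *m qeta.
Definition qdelta2 : C := (qeta^t* *m qeta) 0 0.
Definition qJ : 'M[C]_n := qeta *m qeta^t*.

(* A^* = (id (x) R^dag) (id (x) A^dag (x) id) (R (x) id); the casts are the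
   canonical identifications involving associativity and C. *)
Definition qconj (A : 'M[C]_n) : 'M[C]_n :=
  castmx (muln1 n, mul1n n)
    (((1%:M : 'M_n) *t qR^t*) *m
     castmx (esym (mulnA n n n), erefl (1 * n)%N)
       ((((1%:M : 'M_n) *t A^t*) *t (1%:M : 'M_n)) *m (qR *t (1%:M : 'M_n)))).

(* A . B = m (A (x) B) m^dag, for scalar matrices and for matrices with entries
   in a *-algebra *)
Definition schur (A B : 'M[C]_n) : 'M[C]_n := qm *m (A *t B) *m qm^t*.
Definition schurA (O : starAlgType C) (u v : 'M[O]_n) : 'M[O]_n :=
  liftmx O qm *m (u *t v) *m liftmx O (qm^t*).

Definition qhadamard (H : 'M[C]_n) : Prop :=
  [/\ qconj H = H, schur H H = qJ,
      H *m H^t* = qdelta2%:M & H^t* *m H = qdelta2%:M].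

Definition cubic (O : starAlgType C) (u : 'M[O]_n) : Prop :=
  [/\ unitary u, (u *t u) *m liftmx O qR = liftmx O qR
    & (u *t u) *m liftmx O (qm^t* *m qm) = liftmx O (qm^t* *m qm) *m (u *t u)].

Definition hconj (H : 'M[C]_n) (O : starAlgType C) (u : 'M[O]_n) : 'M[O]_n :=
  liftmx O H *m u *m liftmx O (invmx H).

Definition had_rel (H : 'M[C]_n) (O : starAlgType C) (u : 'M[O]_n) : Prop :=
  cubic u /\ cubic (hconj H u).

Definition graph_rel (A : 'M[C]_n) (O : starAlgType C) (u : 'M[O]_n) : Prop :=
  [/\ unitary u, u *m liftmx O qm = liftmx O qm *m (u *t u),
      liftmx O (qeta^t*) *m u = liftmx O (qeta^t*)
    & u *m liftmx O A = liftmx O A *m u].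

Definition acts (G : qgroup C) (A : 'M[C]_n) (u : 'M[G]_n) : Prop :=
  graph_rel A u /\ corep u.

Lemma qconjE (A : 'M[C]_n) i j : qconj A i j =
  \sum_k \sum_l qR (mxtens_index (i, k)) 0 * (A k l)^* *
                (qR (mxtens_index (l, j)) 0)^*.
Proof.
rewrite /qconj castmxE mxE sum_tens.
have -> : cast_ord (esym (muln1 n)) i = mxtens_index (i, ord0 : 'I_1).
  by apply: val_inj; rewrite /= muln1 addn0.
have -> : cast_ord (esym (mul1n n)) j = mxtens_index (ord0 : 'I_1, j).
  by apply: val_inj.
rewrite (bigD1 i) //= [X in _ + X]big1 ?addr0; last first.
  move=> a ai; rewrite big1 // => bc _.
  by rewrite tensmxE mxE eq_sym (negPf ai) !mul0r.
rewrite exchange_big /= sum_tens; apply: eq_bigr => b _.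
have mid c : castmx (esym (mulnA n n n), erefl (1 * n)%N)
    ((1%:M *t A^t* *t 1%:M) *m (qR *t (1%:M : 'M_n)))
    (mxtens_index (i, mxtens_index (b, c))) (mxtens_index (ord0 : 'I_1, j)) =
    \sum_k (qR (mxtens_index (i, k)) 0 * (A k b)^*) * (c == j)%:R.
  rewrite castmxE esymK /= cast_ord_id.
  have -> : cast_ord (mulnA n n n) (mxtens_index (i, mxtens_index (b, c))) =
            mxtens_index (mxtens_index (i, b), c).
    by apply: val_inj; rewrite /= mulnDl mulnA addnA.
  rewrite mxE sum_tens sum_tens (bigD1 i) //= [X in _ + X]big1 ?addr0; last first.
    move=> a ai; rewrite big1 // => d _; rewrite big1 // => e _.
    by rewrite !tensmxE !mxE eq_sym (negPf ai) !mul0r.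
  apply: eq_bigr => k _; rewrite (bigD1 c) //= [X in _ + X]big1 ?addr0; last first.
    move=> a ai; rewrite !tensmxE [X in _ * X * _]mxE.
    by rewrite eq_sym (negPf ai) mulr0 mul0r.
  rewrite !tensmxE [_^t* _ _]mxE [_^T _ _]mxE [1%:M i i]mxE [1%:M c c]mxE [1%:M c j]mxE !eqxx !mul1r.
  by rewrite mulr1 mulrCA mulrA.
rewrite (eq_bigr _ (fun c _ => congr1 (fun z => _ * z) (mid c))).
rewrite (bigD1 j) //= [X in _ + X]big1 ?addr0; last first.
  move=> a aj; rewrite big1 ?mulr0 // => k _.
  by rewrite (negPf aj) mulr0.
rewrite eqxx mulr_sumr; apply: eq_bigr => k _.
rewrite tensmxE [1%:M _ _]mxE eqxx mul1r mulr1 mulrC; congr (_ * _).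
by rewrite mxE [_^T _ _]mxE.
Qed.
End QSpace.

Lemma tens_sum_split (C : pzRingType) p q (F : 'I_(p + q) -> 'I_(p + q) -> C) :
  \sum_(k < (p + q) * (p + q)) F (mxtens_unindex k).1 (mxtens_unindex k).2 =
  (\sum_i \sum_j F (lshift q i) (lshift q j) +
   \sum_i \sum_j F (lshift q i) (rshift p j)) +
  (\sum_i \sum_j F (rshift p i) (lshift q j) +
   \sum_i \sum_j F (rshift p i) (rshift p j)).
Proof.
transitivity (\sum_i \sum_j F i j).
  rewrite sum_tens; apply: eq_bigr => i _; apply: eq_bigr => j _.
  by rewrite mxtens_indexK.
rewrite big_split_ord /=; congr (_ + _);
  rewrite -big_split; apply: eq_bigr => i _ /=;
  by rewrite big_split_ord.
Qed.

(* The disjoint union of X1 and X2: C(X1) (+) C(X2) with the sum of the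
   functionals. *)
Section QSum.
Variables (C : numClosedFieldType) (X1 X2 : qspace C).
Local Notation A := (qfun X1 * qfun X2)%type.

Definition qsum_psi (x : A) : C := qpsi X1 x.1 + qpsi X2 x.2.

Definition qsum_onb (i : 'I_(qdim X1 + qdim X2)) : A :=
  match split i with
  | inl j => (qonb j, 0)
  | inr j => (0, qonb j)
  end.

Fact qsum_psi_additive : zmod_morphism qsum_psi.
Proof. by move=> x y; rewrite /qsum_psi !raddfB addrACA opprD. Qed.
HB.instance Definition _ := GRing.isZmodMorphism.Build A C qsum_psi
  qsum_psi_additive.

Fact qsum_psi_scal (c : C) (a : A) : qsum_psi (scal c * a) = c * qsum_psi a.
Proof. by rewrite /qsum_psi /= !qpsi_scal mulrDr. Qed.

Fact qsum_psi_ge0 (a : A) : 0 <= qsum_psi (star a * a).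
Proof. by rewrite addr_ge0 ?qpsi_ge0. Qed.

Fact qsum_psi_nondegl (a : A) : (forall b, qsum_psi (a * b) = 0) -> a = 0.
Proof.
case: a => a1 a2 h; congr pair; apply: qpsi_nondegl => b.
  by have := h (b, 0); rewrite /qsum_psi /= mulr0 raddf0 addr0.
by have := h (0, b); rewrite /qsum_psi /= mulr0 raddf0 add0r.
Qed.

Fact qsum_psi_nondegr (b : A) : (forall a, qsum_psi (a * b) = 0) -> b = 0.
Proof.
case: b => b1 b2 h; congr pair; apply: qpsi_nondegr => a.
  by have := h (a, 0); rewrite /qsum_psi /= mul0r raddf0 addr0.
by have := h (0, a); rewrite /qsum_psi /= mul0r raddf0 add0r.
Qed.

Fact qsum_onbl i : qsum_onb (lshift _ i) = (qonb i, 0).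
Proof. by rewrite /qsum_onb -[lshift _ i]/(unsplit (inl i)) unsplitK. Qed.
Fact qsum_onbr i : qsum_onb (rshift _ i) = (0, qonb i).
Proof. by rewrite /qsum_onb -[rshift _ i]/(unsplit (inr i)) unsplitK. Qed.

Fact qsum_onb_orth i j :
  qsum_psi (star (qsum_onb i) * qsum_onb j) = (i == j)%:R.
Proof.
rewrite -(splitK i) -(splitK j) (inj_eq (can_inj (@unsplitK _ _))).
case: (split i) => {}i; case: (split j) => {}j; rewrite /unsplit /qsum_psi
  ?(qsum_onbl, qsum_onbr) /= ?(star0, mulr0, mul0r, raddf0, addr0, add0r) //;
  exact: qonb_orth.
Qed.

Fact qsum_onb_span (a : A) :
  a = \sum_i scal (qsum_psi (star (qsum_onb i) * a)) * qsum_onb i.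
Proof.
case: a => a1 a2; rewrite big_split_ord /=.
rewrite {1}(_ : (a1, a2) = (a1, 0) + (0, a2) :> A); last first.
  by congr pair; rewrite ?addr0 ?add0r.
congr (_ + _); apply: injective_projections; rewrite raddf_sum /=.
- rewrite {1}[a1]qonb_span; apply: eq_bigr => i _.
  by rewrite qsum_onbl /qsum_psi /= star0 mul0r raddf0 addr0.
- by rewrite big1 // => i _; rewrite qsum_onbl /= mulr0.
- by rewrite big1 // => i _; rewrite qsum_onbr /= mulr0.
- rewrite {1}[a2]qonb_span; apply: eq_bigr => i _.
  by rewrite qsum_onbr /qsum_psi /= star0 mul0r raddf0 add0r.
Qed.

Fact qsum_special :
  mult_mx qsum_psi qsum_onb *m (mult_mx qsum_psi qsum_onb)^t* = 1%:M.
Proof.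
pose F i k a b :=
  qsum_psi (star (qsum_onb i) * (qsum_onb a * qsum_onb b)) *
  (qsum_psi (star (qsum_onb k) * (qsum_onb a * qsum_onb b)))^*.
apply/matrixP => i k; rewrite mxE.
transitivity (\sum_(j < (qdim X1 + qdim X2) * (qdim X1 + qdim X2))
  F i k (mxtens_unindex j).1 (mxtens_unindex j).2).
  by apply: eq_bigr => j _; rewrite !mxE.
rewrite tens_sum_split mxE.
have s1 i1 k1 : \sum_a \sum_b qpsi X1 (star (qonb i1) * (qonb a * qonb b)) *
    (qpsi X1 (star (qonb k1) * (qonb a * qonb b)))^* = (i1 == k1)%:R.
  have /matrixP/(_ i1 k1) := qspecial X1; rewrite !mxE => <-.
  rewrite sum_tens; apply: eq_bigr => a _; apply: eq_bigr => b _.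
  by rewrite !mxE !mxtens_indexK.
have s2 i1 k1 : \sum_a \sum_b qpsi X2 (star (qonb i1) * (qonb a * qonb b)) *
    (qpsi X2 (star (qonb k1) * (qonb a * qonb b)))^* = (i1 == k1)%:R.
  have /matrixP/(_ i1 k1) := qspecial X2; rewrite !mxE => <-.
  rewrite sum_tens; apply: eq_bigr => a _; apply: eq_bigr => b _.
  by rewrite !mxE !mxtens_indexK.
have F0 i1 k1 a b : qsum_onb a * qsum_onb b = 0 -> F i1 k1 a b = 0.
  by rewrite /F => ->; rewrite mulr0 raddf0 mul0r.
have lr a b : qsum_onb (lshift _ a) * qsum_onb (rshift _ b) = 0.
  by rewrite qsum_onbl qsum_onbr; congr pair; rewrite /= ?mulr0 ?mul0r.
have rl a b : qsum_onb (rshift _ a) * qsum_onb (lshift _ b) = 0.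
  by rewrite qsum_onbl qsum_onbr; congr pair; rewrite /= ?mulr0 ?mul0r.
rewrite [X in _ + X + _]big1 => [|a _]; last by rewrite big1 // => b _; rewrite F0.
rewrite [X in _ + (X + _)]big1 => [|a _]; last by rewrite big1 // => b _; rewrite F0.
rewrite addr0 add0r /F {F F0}.
under eq_bigr do under eq_bigr do rewrite !qsum_onbl.
under [X in _ + X]eq_bigr do under eq_bigr do rewrite !qsum_onbr.
rewrite -(splitK i) -(splitK k) (inj_eq (can_inj (@unsplitK _ _))).
case: (split i) => {}i; case: (split k) => {}k; rewrite /unsplit /qsum_psi
  ?(qsum_onbl, qsum_onbr) /=.
- rewrite [X in _ + X]big1 => [|a _]; last first.
    by rewrite big1 // => b _; rewrite ?(star0, mul0r, mulr0, raddf0, addr0, add0r).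
  rewrite addr0 -s1; apply: eq_bigr => a _; apply: eq_bigr => b _.
  by rewrite ?(star0, mul0r, mulr0, raddf0, addr0, add0r).
- rewrite !big1 ?addr0 // => a _; rewrite big1 // => b _.
    by rewrite ?(star0, mul0r, mulr0, raddf0, addr0, add0r).
  by rewrite ?(star0, mul0r, mulr0, raddf0, addr0, add0r).
- rewrite !big1 ?addr0 // => a _; rewrite big1 // => b _.
    by rewrite ?(star0, mul0r, mulr0, raddf0, addr0, add0r).
  by rewrite ?(star0, mul0r, mulr0, raddf0, addr0, add0r).
- rewrite big1 => [|a _]; last first.
    by rewrite big1 // => b _; rewrite ?(star0, mul0r, mulr0, raddf0, addr0, add0r).
  rewrite add0r -s2; apply: eq_bigr => a _; apply: eq_bigr => b _.
  by rewrite ?(star0, mul0r, mulr0, raddf0, addr0, add0r).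
Qed.


Definition qsum : qspace C := @QSpace C A qsum_psi _ qsum_onb
  qsum_psi_scal qsum_psi_ge0 qsum_psi_nondegl qsum_psi_nondegr
  qsum_onb_orth qsum_onb_span qsum_special.
End QSum.

Section Relations.
Variables (C : numClosedFieldType) (X : qspace C).
Local Notation n := (qdim X).

Lemma cubic_hom (A B : starAlgType C) (f : starHom A B) (u : 'M[A]_n) :
  cubic u -> cubic (map_mx f u).
Proof.
case=> u1 u2 u3; split; first exact: unitary_hom.
  by rewrite -(map_liftmx f) -map_mxT -map_mxM u2.
by rewrite -(map_liftmx f) -map_mxT -!map_mxM u3.
Qed.

Lemma cubicM (A : starAlgType C) (u v : 'M[A]_n) :
  (forall i j k l, GRing.comm (u i j) (v k l)) ->
  cubic u -> cubic v -> cubic (u *m v).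
Proof.
move=> uv [u1 u2 u3] [v1 v2 v3]; split; first exact: unitaryM.
  by rewrite tensmx_mul_comm // -mulmxA v2 u2.
by rewrite tensmx_mul_comm // -mulmxA v3 mulmxA u3 mulmxA.
Qed.

Lemma hconj_hom H (A B : starAlgType C) (f : starHom A B) (u : 'M[A]_n) :
  hconj H (map_mx f u) = map_mx f (hconj H u).
Proof. by rewrite /hconj -!(map_liftmx f) -!map_mxM. Qed.

Lemma had_rel_hom H : mxrel_hom (@had_rel C X H).
Proof.
move=> A B f u [u1 u2]; split; first exact: cubic_hom.
by rewrite hconj_hom; apply: cubic_hom.
Qed.

Lemma cubic_ext P (u : 'M[@mxalg C n P]_n) :
  (forall (B : starAlgType C) (v : 'M[B]_n) (Pv : P B v),
     cubic (map_mx (mxlift Pv) u)) -> cubic u.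
Proof.
move=> h; split; first split; apply: mxalg_ext => B v Pv;
  have [[u1 u1'] u2 u3] := h B v Pv;
  by rewrite !map_mxh.
Qed.

Lemma had_rel_gen H : mxrel_gen (@had_rel C X H).
Proof.
split; apply: cubic_ext => B v [v1 v2]; first by rewrite mxliftE.
by rewrite -hconj_hom mxliftE.
Qed.

Lemma qeta_eq0 : qeta X = 0 -> n = 0%N.
Proof.
move=> eta0.
have one0 : 1 = 0 :> qfun X.
  rewrite [LHS]qonb_span big1 // => i _.
  by have /matrixP/(_ i 0) := eta0; rewrite !mxE => ->; rewrite rmorph0 mul0r.
case: (posnP n) => // n0; have := qonb_orth (Ordinal n0) (Ordinal n0).
rewrite -[_ * _]mul1r one0 mul0r raddf0 eqxx => /esym/eqP.
by rewrite oner_eq0.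
Qed.

Lemma qdelta2_neq0 : (0 < n)%N -> qdelta2 X != 0.
Proof.
move=> n0; apply/eqP => d0; suff /qeta_eq0 e : qeta X = 0 by rewrite e in n0.
move: d0; rewrite /qdelta2 mxE => /eqP; rewrite psumr_eq0; last first.
  by move=> i _; rewrite !mxE -normCKC exprn_ge0.
move=> /allP h; apply/matrixP => i j; rewrite (ord1 j).
have := h i (mem_index_enum _); rewrite [_^t* _ _]mxE [_^T _ _]mxE -normCKC.
by rewrite sqrf_eq0 normr_eq0 [(0 : 'M_(_, _)) _ _]mxE => /eqP.
Qed.

Lemma qhadamard_unit (H : 'M[C]_n) : qhadamard H -> H \in unitmx.
Proof.
case=> _ _ hH _; case: (posnP n) => [n0|/qdelta2_neq0 d0].
  rewrite unitmxE; move: H {hH}; rewrite n0 => H.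
  by rewrite det_mx00 unitr1.
apply: (@proj1 _ _ (@mulmx1_unit _ _ H ((qdelta2 X)^-1 *: H^t*) _)).
by rewrite -scalemxAr hH scale_scalar_mx mulVf.
Qed.

Lemma hconjM (H : 'M[C]_n) (A : starAlgType C) (u v : 'M[A]_n) : H \in unitmx ->
  hconj H (u *m v) = hconj H u *m hconj H v.
Proof.
move=> Hu; rewrite /hconj !mulmxA -(mulmxA _ _ (liftmx A H)) -liftmxM mulVmx //.
by rewrite liftmx1 mulmx1.
Qed.

Lemma had_rel_mul (H : 'M[C]_n) : qhadamard H -> mxrel_mul (@had_rel C X H).
Proof.
move=> /qhadamard_unit Hu A u v uv [u1 u2] [v1 v2]; split; first exact: cubicM.
rewrite hconjM //; apply: cubicM => // i j k l.
apply: mulmx_comm => [i1 j1 k1 l1|i1 j1 k1 l1]; last exact: liftmx_comm.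
apply: mulmx_comm => [i2 j2 k2 l2|i2 j2 k2 l2]; first exact: liftmx_comm.
apply/commr_sym; apply: mulmx_comm => [i3 j3 k3 l3|i3 j3 k3 l3];
  last exact: liftmx_comm.
apply: mulmx_comm => [i4 j4 k4 l4|i4 j4 k4 l4]; first exact: liftmx_comm.
exact/commr_sym.
Qed.

Lemma graph_rel_hom T : mxrel_hom (@graph_rel C X T).
Proof.
move=> A B f u [u1 u2 u3 u4]; split; first exact: unitary_hom.
- by rewrite -(map_liftmx f) -map_mxT -!map_mxM u2.
- by rewrite -(map_liftmx f) -map_mxM u3.
- by rewrite -(map_liftmx f) -!map_mxM u4.
Qed.

Lemma graph_rel_gen T : mxrel_gen (@graph_rel C X T).
Proof.
split; first split; apply: mxalg_ext => B v Pv;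
  have [[v1 v1'] v2 v3 v4] := Pv; by rewrite !map_mxh mxliftE.
Qed.

Lemma graph_rel_mul T : mxrel_mul (@graph_rel C X T).
Proof.
move=> A u v uv [u1 u2 u3 u4] [v1 v2 v3 v4]; split; first exact: unitaryM.
- by rewrite tensmx_mul_comm // -mulmxA v2 mulmxA u2 mulmxA.
- by rewrite mulmxA u3 v3.
- by rewrite -mulmxA v4 mulmxA u4 mulmxA.
Qed.

Definition AutH (H : 'M[C]_n) (hH : qhadamard H) : qgroup C :=
  mxqgroup (had_rel_gen H) (@had_rel_hom H) (had_rel_mul hH).

Definition AutH_rep (H : 'M[C]_n) (hH : qhadamard H) : 'M[AutH hH]_n :=
  mxgen (@had_rel C X H).

Definition AutG (A : 'M[C]_n) : qgroup C :=
  mxqgroup (graph_rel_gen A) (@graph_rel_hom A) (@graph_rel_mul A).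

Definition AutG_rep (A : 'M[C]_n) : 'M[AutG A]_n := mxgen (@graph_rel C X A).
End Relations.

Section HadamardGraphs.
Variables (C : numClosedFieldType) (X : qspace C).
Local Notation n := (qdim X).

(* X |_| X |_| X |_| X; the basis of [qsum] follows the block order of block_mx. *)
Definition qsum4 : qspace C := qsum (qsum X X) (qsum X X).

Definition mx4 (T : Type) (A B D E : 'M[T]_(n + n)) : 'M[T]_(qdim qsum4) :=
  block_mx A B D E.

Definition Hplus (H : 'M[C]_n) : 'M[C]_n := 2^-1 *: (qJ X + H).
Definition Hminus (H : 'M[C]_n) : 'M[C]_n := 2^-1 *: (qJ X - H).

Definition hgraph_offdiag (H : 'M[C]_n) : 'M[C]_(n + n) :=
  block_mx (Hplus H) (Hminus H) (Hminus H) (Hplus H).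
Definition hgraph_offdiag_adj (H : 'M[C]_n) : 'M[C]_(n + n) :=
  block_mx ((Hplus H)^t*) ((Hminus H)^t*) ((Hminus H)^t*) ((Hplus H)^t*).

Definition hgraph (H : 'M[C]_n) : 'M[C]_(qdim qsum4) :=
  mx4 (block_mx 0 0 0 0) (hgraph_offdiag H) (hgraph_offdiag_adj H)
      (block_mx 0 0 0 0).
Definition hgraph0 (H : 'M[C]_n) : 'M[C]_(qdim qsum4) :=
  mx4 (block_mx 1%:M 0 0 1%:M) (hgraph_offdiag H) (hgraph_offdiag_adj H)
      (block_mx 0 0 0 0).

Definition uplus (O : starAlgType C) (u : 'M[O]_n) : 'M[O]_n :=
  scal 2^-1 *: (schurA u u + u).
Definition uminus (O : starAlgType C) (u : 'M[O]_n) : 'M[O]_n :=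
  scal 2^-1 *: (schurA u u - u).

Definition hgraph_action (H : 'M[C]_n) (hH : qhadamard H) :
    'M[AutH hH]_(qdim qsum4) :=
  let q := AutH_rep hH in
  let p := hconj H q in
  mx4 (block_mx (uplus p) (uminus p) (uminus p) (uplus p)) 0
      0 (block_mx (uplus q) (uminus q) (uminus q) (uplus q)).
End HadamardGraphs.

(* Main.v *)
Require Import Defs.
From HB Require Import structures.
From mathcomp Require Import all_boot all_order all_algebra reals.
From mathcomp.real_closed Require Import complex.

(** Two copies of C(X) split into even vectors (x, x) and odd vectors (x, -x).
    In this decomposition ([evodd]) the off-diagonal block B of the adjacency
    matrices is J on even vectors and H on odd ones, and the proposed action is
    block diagonal, each of its two blocks being [double_rep u]: the Schur
    square of u on even vectors and u on odd ones, for u = p and u = q.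

    The action exists. Write a for the Schur square of a cubic u, and view u and
    a as maps from C(X) to the algebra C(X) (x) A. Cubicity says that a(1) = 1
    and u(x) u(y) = a(xy). Then s = u(1) is an involution with
    s u(x) = a(x) = u(x) s, and associativity yields that a is multiplicative and
    a(x) u(y) = u(xy) = u(x) a(y) ([cubic_graded]). Thus [double_rep u] is a
    multiplicative unitary for the grading in which odd times odd is even. It
    commutes with the adjacency matrices because p H = H q and because a fixes
    the unit ([had_action_graph_rel]).

    Conversely, let w satisfy the relations of the second graph. It fixes 1,
    hence also A_0 1 = (1 + delta^2, delta^2), and therefore the indicator of the
    first half of Y, where A_0 has its diagonal block. A multiplicative w fixing
    an indicator commutes with the corresponding projection
    ([multiplicative_fix_block_diag]), so w is block diagonal with blocks P, Q,
    and P B = B Q together with its adjoint relation shows that P commutes with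
    B B', that is, with J on even vectors and 1 on odd vectors, up to the factor
    delta^2. As P fixes 1 it commutes with the even part, hence with the
    projection onto odd vectors ([evodd_of_commute]). So P acts by some a on even
    and some p on odd vectors; multiplicativity gives p(x) p(y) = a(xy), and this
    makes p cubic with Schur square a ([cubic_of_graded]). The same holds for Q,
    with q in place of p, and P B = B Q gives p H = H q. Hence w is the action
    matrix of q ([graph_rel_had_action]).

    The two constructions are inverse to each other on matrices over every
    star-algebra, so they induce inverse star-isomorphisms of the universal
    algebras. The isomorphism respects comultiplications because the action is a
    corepresentation ([had_action_mul]). *)

Set Implicit Arguments.
Unset Strict Implicit.
Unset Printing Implicit Defensive.

Import GRing.Theory Num.Theory.
Local Open Scope ring_scope.
Local Open Scope sesquilinear_scope.

(** * The algebra C(X) (x) A in coordinates *)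

Section Columns.
Variables (C : numClosedFieldType) (X : qspace C).
Local Notation n := (qdim X).

Definition coord (x : qfun X) : 'cV[C]_n := \col_i qpsi X (star (qonb i) * x).

Lemma coordD : {morph coord : x y / x + y}.
Proof. by move=> x y; apply/matrixP => i j; rewrite !mxE mulrDr raddfD. Qed.

Lemma coord0 : coord 0 = 0.
Proof. by apply/matrixP => i j; rewrite !mxE mulr0 raddf0. Qed.

Lemma coord1 : coord 1 = qeta X.
Proof. by []. Qed.

Lemma coord_onb i : coord (qonb i) = delta_mx i 0.
Proof. by apply/matrixP => j k; rewrite !mxE qonb_orth (ord1 k) eqxx andbT. Qed.

(** Structure constants are values of psi of this form, so this expansion turns
    associativity and the unit laws of C(X) into identities between them. *)
Lemma psi_mul_onb (a b x : qfun X) :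
  qpsi X (a * x * b) = \sum_i qpsi X (a * qonb i * b) * coord x i 0.
Proof.
rewrite {1}[x]qonb_span mulr_sumr mulr_suml raddf_sum; apply: eq_bigr => i _.
by rewrite !mulrA -(scalC _ a) -!mulrA qpsi_scal mulrC mxE mulrA.
Qed.

Lemma coordM x y : coord (x * y) = qm X *m (coord x *t coord y) :> 'M_(n, 1).
Proof.
apply/matrixP => i j; rewrite !mxE sum_tens mulrA psi_mul_onb.
apply: eq_bigr => a _; rewrite -[in LHS](mulr1 y) mulrA psi_mul_onb mulr_suml.
apply: eq_bigr => b _; rewrite !mxE !mxtens_indexK /= !mulr1.
by rewrite -!mulrA [qpsi _ (star (qonb b) * y) * _]mulrC.
Qed.

Section Coefficients.
Variable A : starAlgType C.
Implicit Types (x y z : 'cV[A]_n) (c : C).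

(** The product of C(X) (x) A, on columns of coordinates in A. The entries of the
    two factors keep their order, so this product is associative and unital for
    noncommutative A. *)
Definition colmul (x y : 'cV[A]_n) : 'cV[A]_n := liftmx A (qm X) *m (x *t y).

Lemma colmulE x y i : colmul x y i 0 =
  \sum_a \sum_b scal (coord (qonb a * qonb b) i 0) * (x a 0 * y b 0).
Proof.
rewrite mxE sum_tens; apply: eq_bigr => a _; apply: eq_bigr => b _.
rewrite !mxE !mxtens_indexK /=; congr (_ * (x _ _ * y _ _)); exact: ord1.
Qed.

Lemma colmulDl x y z : colmul (x + y) z = colmul x z + colmul y z.
Proof.
rewrite /colmul -mulmxDr; congr (_ *m _).
by apply/matrixP => i j; rewrite !mxE mulrDl.
Qed.

Lemma colmulDr x y z : colmul x (y + z) = colmul x y + colmul x z.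
Proof.
rewrite /colmul -mulmxDr; congr (_ *m _).
by apply/matrixP => i j; rewrite !mxE mulrDr.
Qed.

Lemma scale_mulmx m p q (M : 'M[A]_(m, p)) (N : 'M[A]_(p, q)) c :
  M *m (scal c *: N) = scal c *: (M *m N).
Proof.
apply/matrixP => i j; rewrite !mxE mulr_sumr; apply: eq_bigr => k _.
by rewrite !mxE !mulrA scalC.
Qed.

Lemma colmulZl c x y : colmul (scal c *: x) y = scal c *: colmul x y.
Proof.
rewrite /colmul -scale_mulmx; congr (_ *m _).
by apply/matrixP => i j; rewrite !mxE mulrA.
Qed.

Lemma colmulZr c x y : colmul x (scal c *: y) = scal c *: colmul x y.
Proof.
rewrite /colmul -scale_mulmx; congr (_ *m _).
by apply/matrixP => i j; rewrite !mxE !mulrA scalC.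
Qed.

Lemma colmul0l x : colmul 0 x = 0.
Proof. by rewrite /colmul tens0mx mulmx0. Qed.

Lemma colmul0r x : colmul x 0 = 0.
Proof. by rewrite /colmul tensmx0 mulmx0. Qed.

Lemma colmulNl x y : colmul (- x) y = - colmul x y.
Proof. by apply/(addIr (colmul x y)); rewrite -colmulDl !addNr colmul0l. Qed.

Lemma colmulNr x y : colmul x (- y) = - colmul x y.
Proof. by apply/(addIr (colmul x y)); rewrite -colmulDr !addNr colmul0r. Qed.

(** Both sides expand to the sum over a, b, c of e_a e_b e_c (x) x_a y_b z_c. *)
Lemma colmulA x y z : colmul x (colmul y z) = colmul (colmul x y) z.
Proof.
apply/matrixP => i j; rewrite (ord1 j) !colmulE.
transitivity (\sum_a \sum_b \sum_c scal (coord (qonb a * qonb b * qonb c) i 0) *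
    (x a 0 * y b 0 * z c 0)).
  apply: eq_bigr => a _.
  under eq_bigr => k _ do rewrite colmulE mulr_sumr mulr_sumr.
  rewrite exchange_big; apply: eq_bigr => b _ /=.
  under eq_bigr => k _ do rewrite mulr_sumr mulr_sumr.
  rewrite exchange_big; apply: eq_bigr => c _ /=.
  rewrite mxE -mulrA mulrA -[E in qpsi X E]mulr1 psi_mul_onb rmorph_sum mulr_suml.
  apply: eq_bigr => k _; rewrite mulr1 mxE rmorphM !mulrA -[_ * x _ _ * scal _]mulrA.
  by rewrite -scalC !mulrA.
transitivity (\sum_c \sum_a \sum_b scal (coord (qonb a * qonb b * qonb c) i 0) *
    (x a 0 * y b 0 * z c 0)).
  rewrite [RHS]exchange_big /=; apply: eq_bigr => a _; exact: exchange_big.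
rewrite [RHS]exchange_big /=; apply: eq_bigr => c _.
rewrite [RHS](eq_bigr (fun k => \sum_a \sum_b scal (coord (qonb k * qonb c) i 0) *
    (scal (coord (qonb a * qonb b) k 0) * (x a 0 * y b 0) * z c 0))); last first.
  move=> k _; rewrite colmulE mulr_suml mulr_sumr; apply: eq_bigr => a _.
  by rewrite mulr_suml mulr_sumr.
rewrite [RHS]exchange_big; apply: eq_bigr => a _ /=.
rewrite [RHS]exchange_big; apply: eq_bigr => b _ /=.
rewrite mxE mulrA psi_mul_onb rmorph_sum mulr_suml.
by apply: eq_bigr => k _; rewrite [coord (qonb k * qonb c) i 0]mxE
  rmorphM !mulrA.
Qed.

Lemma colmul1l x : colmul (liftmx A (qeta X)) x = x.
Proof.
apply/matrixP => i j; rewrite (ord1 j) colmulE exchange_big /=.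
rewrite (eq_bigr (fun b => scal (qpsi X (star (qonb i) * qonb b)) * x b 0)) => [|b _].
  rewrite (bigD1 i) //= big1 ?addr0 => [|b bi].
    by rewrite qonb_orth eqxx rmorph1 mul1r.
  by rewrite qonb_orth eq_sym (negPf bi) rmorph0 mul0r.
rewrite -[in RHS](mulr1 (star _)) psi_mul_onb rmorph_sum mulr_suml.
by apply: eq_bigr => a _; rewrite !mxE rmorphM !mulrA.
Qed.

Lemma colmul1r x : colmul x (liftmx A (qeta X)) = x.
Proof.
apply/matrixP => i j; rewrite (ord1 j) colmulE /=.
rewrite (eq_bigr (fun b => scal (qpsi X (star (qonb i) * qonb b)) * x b 0)) => [|a _].
  rewrite (bigD1 i) //= big1 ?addr0 => [|b bi].
    by rewrite qonb_orth eqxx rmorph1 mul1r.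
  by rewrite qonb_orth eq_sym (negPf bi) rmorph0 mul0r.
rewrite -[in RHS](mulr1 (star _ * _)) -[E in qpsi X E]mulr1 psi_mul_onb.
rewrite rmorph_sum mulr_suml.
apply: eq_bigr => b _; rewrite mulr1 !mxE rmorphM !mulrA -!mulrA; congr (_ * _).
by rewrite scalC.
Qed.

End Coefficients.

Section Evaluation.
Variable A : starAlgType C.
Implicit Types (x y : qfun X) (u v w : 'M[A]_n) (c : C).

(** The value at x of the map C(X) -> C(X) (x) A with matrix u. *)
Definition coact (u : 'M[A]_n) (x : qfun X) : 'cV[A]_n := u *m liftmx A (coord x).

Lemma coactDl u v x : coact (u + v) x = coact u x + coact v x.
Proof. exact: mulmxDl. Qed.

Lemma coactNl u x : coact (- u) x = - coact u x.
Proof. exact: mulNmx. Qed.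

Lemma coactZl c u x : coact (scal c *: u) x = scal c *: coact u x.
Proof. by rewrite /coact scalemxAl. Qed.

Lemma coactD u x y : coact u (x + y) = coact u x + coact u y.
Proof. by rewrite /coact coordD /liftmx map_mxD mulmxDr. Qed.

Lemma coactN u x : coact u (- x) = - coact u x.
Proof.
apply/(addIr (coact u x)); rewrite -coactD !addNr /coact coord0.
by rewrite /liftmx map_mx0 mulmx0.
Qed.

Lemma liftmxZ m k c (M : 'M[C]_(m, k)) : liftmx A (c *: M) = scal c *: liftmx A M.
Proof. exact: map_mxZ. Qed.

Lemma liftmx_tens m k p q (M : 'M[C]_(m, k)) (N : 'M[C]_(p, q)) :
  liftmx A (M *t N) = liftmx A M *t liftmx A N.
Proof. exact: map_mxT. Qed.

Lemma mulmx_onb m (M : 'M[A]_(m, n)) i :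
  M *m liftmx A (coord (qonb i)) = col i M.
Proof. by rewrite coord_onb colE /liftmx map_delta_mx. Qed.

Lemma coact_tens u v x y :
  (u *t v) *m (liftmx A (coord x) *t liftmx A (coord y)) = coact u x *t coact v y.
Proof. by rewrite -tensmx_mul_comm // => i j k l; apply/commr_sym/liftmx_comm. Qed.

Lemma liftmx_coordM x y :
  liftmx A (coord (x * y)) = colmul (liftmx A (coord x)) (liftmx A (coord y)).
Proof.
rewrite coordM liftmxM; congr (_ *m _).
exact: (liftmx_tens (coord x) (coord y)).
Qed.

(** Turns a relation between matrices into identities between elements of the
    algebra C(X) (x) A, where associativity and the unit can be used without
    triple tensor products of matrices. *)
Lemma intertwine_multP w u v :
  w *m liftmx A (qm X) = liftmx A (qm X) *m (u *t v) <->
  forall x y, coact w (x * y) = colmul (coact u x) (coact v y).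
Proof.
split=> [h x y|h].
  by rewrite /coact liftmx_coordM mulmxA h -mulmxA coact_tens.
apply/matrixP => i j; case: (mxtens_indexP j) => c d.
move/matrixP/(_ i 0): (h (qonb c) (qonb d)).
rewrite /colmul -coact_tens mulmxA /coact liftmx_coordM mulmxA.
rewrite !coord_onb /liftmx !map_delta_mx.
have -> : (delta_mx c 0 : 'cV[A]_n) *t (delta_mx d 0 : 'cV[A]_n) =
    (delta_mx (mxtens_index (c, d)) 0 : 'M[A]_(n * n, 1)).
  apply/matrixP => k l; case: (mxtens_indexP k) => a b.
  rewrite !mxE !mxtens_indexK /= (can_eq (@mxtens_indexK _ _)) xpair_eqE.
  by rewrite [l]ord1 !ord1 !eqxx !andbT -natrM mulnb.
by rewrite -!colE !mxE.
Qed.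

Definition multiplicative_mx (w : 'M[A]_n) : Prop :=
  w *m liftmx A (qm X) = liftmx A (qm X) *m (w *t w).

End Evaluation.
End Columns.

(** * Unitary matrices over a star-algebra *)

Section Unitary.
Variables (C : numClosedFieldType) (A : starAlgType C).

Lemma star1 : star (1 : A) = 1.
Proof. by rewrite -(rmorph1 (@scal C A)) star_scal conjC1. Qed.

Lemma starN (x : A) : star (- x) = - star x.
Proof. by apply/(addIr (star x)); rewrite -starD !addNr star0. Qed.

Lemma starmxK m n : cancel (@starmx C A m n) (@starmx C A n m).
Proof. by move=> u; apply/matrixP => i j; rewrite !mxE starK. Qed.

Lemma starmx_lift m n (M : 'M[C]_(m, n)) : starmx (liftmx A M) = liftmx A (M^t*).
Proof. by apply/matrixP => i j; rewrite !mxE star_scal. Qed.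

Lemma starmxD m n : {morph @starmx C A m n : u v / u + v}.
Proof. by move=> u v; apply/matrixP => i j; rewrite !mxE starD. Qed.

Lemma starmxN m n : {morph @starmx C A m n : u / - u}.
Proof. by move=> u; apply/matrixP => i j; rewrite !mxE starN. Qed.

Lemma starmxZ m n c (u : 'M[A]_(m, n)) :
  starmx (scal c *: u) = scal c^* *: starmx u.
Proof. by apply/matrixP => i j; rewrite !mxE starM star_scal scalC. Qed.

Lemma starmx0 m n : starmx (0 : 'M[A]_(m, n)) = 0.
Proof. by apply/matrixP => i j; rewrite !mxE star0. Qed.

Lemma starmx_block m n p q (u : 'M[A]_(m, p)) (v : 'M[A]_(m, q))
    (w : 'M[A]_(n, p)) (z : 'M[A]_(n, q)) :
  starmx (block_mx u v w z) =
  block_mx (starmx u) (starmx w) (starmx v) (starmx z).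
Proof. by rewrite /starmx tr_block_mx map_block_mx. Qed.

Lemma tens11 m n : (1%:M : 'M[A]_m) *t (1%:M : 'M[A]_n) = 1%:M.
Proof.
apply/matrixP => i j; case: (mxtens_indexP i) => a b.
case: (mxtens_indexP j) => c d; rewrite tensmxE !mxE.
by rewrite (can_eq (@mxtens_indexK _ _)) xpair_eqE -natrM mulnb.
Qed.

Lemma comm_id n p q (M : 'M[A]_(p, q)) i j k l :
  GRing.comm ((1%:M : 'M[A]_n) i j) (M k l).
Proof. by rewrite mxE; apply/commr_sym/commr_nat. Qed.

Lemma tens_decomp m n (u : 'M[A]_m) (v : 'M[A]_n) :
  u *t v = (u *t 1%:M) *m (1%:M *t v).
Proof.
by rewrite -tensmx_mul_comm ?mulmx1 ?mul1mx // => i j k l; apply: comm_id.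
Qed.

(** As the entries of u and v need not commute, the adjoint of u (x) v is not the
    tensor product of the adjoints. It is the product, in reverse order, of the
    adjoints of u (x) 1 and 1 (x) v, which can be cancelled one at a time. *)
Lemma unitary_tens m n (u : 'M[A]_m) (v : 'M[A]_n) :
  unitary u -> unitary v -> unitary (u *t v).
Proof.
move=> [u1 u2] [v1 v2].
have hu : starmx (u *t (1%:M : 'M_n)) = starmx u *t 1%:M.
  apply/matrixP => i j; rewrite !mxE starM eq_sym.
  by case: eqP => _; rewrite ?star1 ?star0 ?mul1r ?mulr1 ?mul0r ?mulr0.
have hv : starmx ((1%:M : 'M_m) *t v) = 1%:M *t starmx v.
  apply/matrixP => i j; rewrite !mxE starM eq_sym.
  by case: eqP => _; rewrite ?star1 ?star0 ?mul1r ?mulr1 ?mul0r ?mulr0.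
have cl i j k l : GRing.comm ((1%:M : 'M[A]_n) i j) (u k l) by apply: comm_id.
have cl' i j k l : GRing.comm ((1%:M : 'M[A]_n) i j) (starmx u k l) by apply: comm_id.
have cr i j k l : GRing.comm (v i j) ((1%:M : 'M[A]_m) k l).
  by apply/commr_sym/comm_id.
have cr' i j k l : GRing.comm (starmx v i j) ((1%:M : 'M[A]_m) k l).
  by apply/commr_sym/comm_id.
split; rewrite tens_decomp starmxM hu hv.
  rewrite mulmxA -(mulmxA (u *t _)) -tensmx_mul_comm // mul1mx v1 tens11.
  by rewrite mulmx1 -tensmx_mul_comm // u1 mul1mx tens11.
rewrite mulmxA -(mulmxA _ (starmx u *t _)) -tensmx_mul_comm // mul1mx u2 tens11.
by rewrite mulmx1 -tensmx_mul_comm // mul1mx v2 tens11.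
Qed.

Lemma unitary_fixl n k (u : 'M[A]_n) (x : 'M[A]_(n, k)) :
  unitary u -> u *m x = x -> starmx x *m u = starmx x.
Proof. by move=> [u1 u2] {1}<-; rewrite starmxM -mulmxA u2 mulmx1. Qed.

Lemma unitary_fixr n k (u : 'M[A]_n) (x : 'M[A]_(n, k)) :
  unitary u -> starmx x *m u = starmx x -> u *m x = x.
Proof.
move=> [u1 u2] /(congr1 (@starmx _ _ _ _)).
by rewrite starmxM starmxK => {1}<-; rewrite mulmxA u1 mul1mx.
Qed.

End Unitary.

(** * Cubic unitaries and the graded multiplicativity they encode *)

Section Cubic.
Variables (C : numClosedFieldType) (X : qspace C) (A : starAlgType C).
Local Notation n := (qdim X).
Local Notation L := (liftmx A).
Implicit Types (u a : 'M[A]_n).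

(** X is special: m m^dagger = id. *)
Lemma qmK : L (qm X) *m L ((qm X)^t*) = 1%:M.
Proof. by rewrite -liftmxM qspecial liftmx1. Qed.

(** The projection m^dagger m commutes with u (x) u, so it can be moved past it
    and absorbed by m. *)
Lemma cubic_mult u : cubic u ->
  schurA u u *m L (qm X) = L (qm X) *m (u *t u).
Proof.
case=> _ _ h; rewrite /schurA -[LHS]mulmxA -liftmxM -mulmxA h liftmxM.
by rewrite !mulmxA qmK mul1mx.
Qed.

Lemma cubic_comult u : cubic u ->
  L ((qm X)^t*) *m schurA u u = (u *t u) *m L ((qm X)^t*).
Proof.
case=> _ _ h; rewrite /schurA !mulmxA -liftmxM -h liftmxM.
by rewrite -!mulmxA qmK mulmx1.
Qed.

(** The unit is m R, and R is fixed by u (x) u. *)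
Lemma cubic_eta u : cubic u -> schurA u u *m L (qeta X) = L (qeta X).
Proof.
case=> _ h _; rewrite /schurA -!mulmxA -liftmxM.
by rewrite -[_ *m qeta X]/(qR X) h /qR liftmxM mulmxA qmK mul1mx.
Qed.

Lemma cubic_schur_unitary u : cubic u -> unitary (schurA u u).
Proof.
move=> cu; have [uu _ _] := cu; have [t1 t2] := unitary_tens uu uu.
have e : starmx (schurA u u) = L (qm X) *m starmx (u *t u) *m L ((qm X)^t*).
  by rewrite /schurA !starmxM !starmx_lift trmxCK mulmxA.
split; rewrite e.
  by rewrite !mulmxA cubic_mult // -(mulmxA _ (u *t u)) t1 mulmx1 qmK.
by rewrite -!mulmxA cubic_comult // (mulmxA _ (u *t u)) t2 mul1mx qmK.
Qed.

(** Let s = u(1). Since u(x) u(y) = a(xy), one gets s u(x) = a(x) = u(x) s, and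
    s^2 = a(1) = 1. So a and u differ by the involution s, on either side, and
    the products involving a follow from u(x) u(y) = a(xy) by associativity. *)
Lemma cubic_graded u (a := schurA u u) : cubic u ->
  [/\ forall x y, colmul (coact u x) (coact u y) = coact a (x * y),
      forall x y, colmul (coact a x) (coact u y) = coact u (x * y),
      forall x y, colmul (coact u x) (coact a y) = coact u (x * y)
    & forall x y, colmul (coact a x) (coact a y) = coact a (x * y)].
Proof.
move=> cu; have h x y : colmul (coact u x) (coact u y) = coact a (x * y).
  by symmetry; move: x y; apply/intertwine_multP/cubic_mult.
have a1 : coact a 1 = L (qeta X) by apply: cubic_eta.
pose s := coact u 1.
have sl x : colmul s (coact u x) = coact a x by rewrite h mul1r.
have sr x : colmul (coact u x) s = coact a x by rewrite h mulr1.
have ss : colmul s s = L (qeta X) by rewrite sl.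
have sal x : colmul s (coact a x) = coact u x by rewrite -sl colmulA ss colmul1l.
have sar x : colmul (coact a x) s = coact u x by rewrite -sr -colmulA ss colmul1r.
have au x y : colmul (coact a x) (coact u y) = coact u (x * y).
  by rewrite -(sl x) -colmulA h sal.
have ua x y : colmul (coact u x) (coact a y) = coact u (x * y).
  by rewrite -(sr y) colmulA h sar.
by split=> // x y; rewrite -(sl x) -colmulA ua sl.
Qed.

(** For unitary a and u the relation a m = m (u (x) u) also holds with daggers,
    (u (x) u) m^dagger = m^dagger a; the three conditions of cubicity and the
    value of the Schur square are read off from these two. *)
Lemma cubic_of_graded u a : unitary u -> unitary a ->
  a *m L (qeta X) = L (qeta X) ->
  (forall x y, colmul (coact u x) (coact u y) = coact a (x * y)) ->
  cubic u /\ schurA u u = a.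
Proof.
move=> uu ua aeta h.
have am : a *m L (qm X) = L (qm X) *m (u *t u).
  by apply/intertwine_multP => x y; rewrite h.
have ma : (u *t u) *m L ((qm X)^t*) = L ((qm X)^t*) *m a.
  have [t1 t2] := unitary_tens uu uu; have [a1 a2] := ua.
  have /(congr1 (@starmx _ _ _ _)) := am; rewrite !starmxM !starmx_lift.
  move/(congr1 (fun M => (u *t u) *m M *m a)).
  by rewrite -!mulmxA a2 mulmx1 !mulmxA t1 mul1mx.
split; last by rewrite /schurA -am -mulmxA qmK mulmx1.
split=> //; first by rewrite /qR liftmxM mulmxA ma -mulmxA aeta.
by rewrite liftmxM mulmxA ma -[LHS]mulmxA am mulmxA.
Qed.

End Cubic.

(** * Even and odd parts over two copies of a space *)

Section EvenOdd.
Variables (C : numClosedFieldType) (A : starAlgType C).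

(** C(X) (+) C(X) is the sum of the even vectors (x, x) and the odd vectors
    (x, -x), each a copy of C(X); this is the map acting as a on the even ones
    and as u on the odd ones. *)
Definition evodd m k (a u : 'M[A]_(m, k)) : 'M[A]_(m + m, k + k) :=
  block_mx (scal 2^-1 *: (a + u)) (scal 2^-1 *: (a - u))
           (scal 2^-1 *: (a - u)) (scal 2^-1 *: (a + u)).

Lemma halfmxK m k (M : 'M[A]_(m, k)) : scal 2^-1 *: (M + M) = M.
Proof.
rewrite -[M in M + M]scale1r -scalerDl scalerA -(rmorph1 (@scal C A)) -rmorphD.
by rewrite -rmorphM mulVf ?rmorph1 ?scale1r // pnatr_eq0.
Qed.

Lemma half_even m k (a u : 'M[A]_(m, k)) :
  scal 2^-1 *: (a + u) + scal 2^-1 *: (a - u) = a.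
Proof. by rewrite -scalerDr addrACA subrr addr0 halfmxK. Qed.

Lemma half_odd m k (a u : 'M[A]_(m, k)) :
  scal 2^-1 *: (a + u) - scal 2^-1 *: (a - u) = u.
Proof. by rewrite -scalerBr opprD opprK addrACA subrr add0r halfmxK. Qed.

Lemma evodd_block m k (b c : 'M[A]_(m, k)) :
  block_mx b c c b = evodd (b + c) (b - c).
Proof.
rewrite /evodd opprB addrACA subrr addr0 halfmxK.
by rewrite [b + c]addrC addrACA subrr addr0 halfmxK.
Qed.

Lemma evodd_inj m k (a u b v : 'M[A]_(m, k)) :
  evodd a u = evodd b v -> a = b /\ u = v.
Proof.
move=> /eq_block_mx [h1 h2 _ _].
by split; [rewrite -(half_even a u) h1 h2 half_even
          |rewrite -(half_odd a u) h1 h2 half_odd].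
Qed.

Lemma evodd_mul m k l (a u : 'M[A]_(m, k)) (b v : 'M[A]_(k, l)) :
  evodd a u *m evodd b v = evodd (a *m b) (u *m v).
Proof.
rewrite /evodd mulmx_block -!scalemxAl !scale_mulmx -!scalerDr.
have mix (u1 : 'M[A]_(m, k)) (v1 : 'M[A]_(k, l)) :
    (a + u1) *m (b + v1) + (a - u1) *m (b - v1) =
    (a *m b + u1 *m v1) + (a *m b + u1 *m v1).
  rewrite !(mulmxDl, mulmxDr, mulmxN, mulNmx) opprK addrACA.
  by rewrite [_ + _ + (_ - _)]addrACA subrr addr0 [E in _ + E]addrACA
    subrr add0r addrACA.
have := (mix u v, mix u (- v), mix (- u) v, mix (- u) (- v)).
rewrite !(mulmxN, mulNmx, opprK) => -[[[-> ->] ->] ->].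
by rewrite !halfmxK.
Qed.

Lemma evodd1 m : evodd (1%:M : 'M[A]_m) 1%:M = 1%:M.
Proof. by rewrite /evodd halfmxK subrr scaler0 -scalar_mx_block. Qed.

Lemma starmx_evodd m k (a u : 'M[A]_(m, k)) :
  starmx (evodd a u) = evodd (starmx a) (starmx u).
Proof.
have h : (2^-1 : C)^* = 2^-1 by rewrite geC0_conj // invr_ge0 ler0n.
by rewrite starmx_block !starmxZ h !starmxD !starmxN.
Qed.

Lemma unitary_evodd m (a u : 'M[A]_m) :
  unitary (evodd a u) <-> unitary a /\ unitary u.
Proof.
rewrite /unitary starmx_evodd !evodd_mul -evodd1.
by split=> [[/evodd_inj[-> ->] /evodd_inj[-> ->]]|[[-> ->] [-> ->]]].
Qed.

Lemma halfmx_inj m k : injective (fun M : 'M[A]_(m, k) => scal 2^-1 *: M).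
Proof. by move=> M N /= h; rewrite -(halfmxK M) scalerDr h -scalerDr halfmxK. Qed.

Lemma evodd_split m k (a u : 'M[A]_(m, k)) : evodd a u = evodd a 0 + evodd 0 u.
Proof.
by rewrite /evodd add_block_mx -!scalerDr !(addr0, add0r, subr0, sub0r).
Qed.

Lemma evodd_scale m k c (a u : 'M[A]_(m, k)) :
  evodd (scal c *: a) (scal c *: u) = scal c *: evodd a u.
Proof.
rewrite /evodd scale_block_mx -!scalerDr -!scalerBr !scalerA.
by rewrite scalC.
Qed.

(** [evodd 0 1%:M] is the projection onto the odd vectors, so w preserves both
    the even and the odd ones. *)
Lemma evodd_commute n (w : 'M[A]_(n + n)) :
  w *m evodd 0 1%:M = evodd 0 1%:M *m w ->
  w = evodd (ulsubmx w + ursubmx w) (ulsubmx w - ursubmx w).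
Proof.
rewrite -evodd_block; move: (submxK w).
move: (ulsubmx w) (ursubmx w) (dlsubmx w) (drsubmx w) => a b c d <-.
rewrite /evodd add0r sub0r !mulmx_block !(scale_mulmx, =^~ scalemxAl) -!scalerDr.
rewrite !(mulmxN, mulNmx, mulmx1, mul1mx).
case/eq_block_mx => /halfmx_inj/addrI/oppr_inj <- /halfmx_inj.
by rewrite addrC => /addrI/oppr_inj ->.
Qed.

End EvenOdd.

Lemma map_evodd (C : numClosedFieldType) (A B : starAlgType C) (f : starHom A B) m k
    (a u : 'M[A]_(m, k)) :
  map_mx f (evodd a u) = evodd (map_mx f a) (map_mx f u).
Proof. by rewrite /evodd map_block_mx !map_mxZ /= !hom_scal map_mxB map_mxD. Qed.

(** * Multiplicative matrices on disjoint unions *)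

Section DisjointUnion.
Variables (C : numClosedFieldType) (X1 X2 : qspace C) (A : starAlgType C).
Local Notation n1 := (qdim X1).
Local Notation n2 := (qdim X2).
Local Notation L := (liftmx A).
Local Notation Y := (qsum X1 X2).

Lemma qonbl i : qonb (lshift n2 i : 'I_(qdim Y)) = (qonb i, 0).
Proof. exact: qsum_onbl. Qed.

Lemma qonbr i : qonb (rshift n1 i : 'I_(qdim Y)) = (0, qonb i).
Proof. exact: qsum_onbr. Qed.

Lemma coord_qsum (x : qfun Y) :
  coord x = col_mx (coord x.1) (coord x.2) :> 'cV_(n1 + n2).
Proof.
apply/matrixP => i j; rewrite (ord1 j) mxE; case: (split_ordP i) => k ->.
  rewrite qonbl col_mxEu mxE -[qpsi Y _]/(qsum_psi _) /qsum_psi /=.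
  by rewrite star0 mul0r raddf0 addr0.
rewrite qonbr col_mxEd mxE -[qpsi Y _]/(qsum_psi _) /qsum_psi /=.
by rewrite star0 mul0r raddf0 add0r.
Qed.

Lemma liftmx_coord_qsum (x : qfun Y) :
  L (coord x) = col_mx (L (coord x.1)) (L (coord x.2)) :> 'cV_(n1 + n2).
Proof. by rewrite coord_qsum /liftmx map_col_mx. Qed.

(** The two summands annihilate each other. *)
Lemma coord_qonbM :
  let inl (a : 'I_n1) := qonb (lshift n2 a : 'I_(qdim Y)) in
  let inr (b : 'I_n2) := qonb (rshift n1 b : 'I_(qdim Y)) in
  [/\ forall a b, coord (inl a * inl b) =
        col_mx (coord (qonb a * qonb b)) 0 :> 'cV_(n1 + n2),
      forall a b, coord (inl a * inr b) = 0 :> 'cV_(n1 + n2),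
      forall a b, coord (inr a * inl b) = 0 :> 'cV_(n1 + n2)
    & forall a b, coord (inr a * inr b) =
        col_mx 0 (coord (qonb a * qonb b)) :> 'cV_(n1 + n2)].
Proof.
split=> a b; rewrite coord_qsum ?qonbl ?qonbr /= ?mul0r ?mulr0.
all: by rewrite ?coord0 ?col_mx0.
Qed.

Lemma colmul_qsum (x1 y1 : 'cV[A]_n1) (x2 y2 : 'cV[A]_n2) :
  colmul (X := Y) (col_mx x1 x2) (col_mx y1 y2) = col_mx (colmul x1 y1) (colmul x2 y2).
Proof.
have [ll lr rl rr] := coord_qonbM.
apply/matrixP => i j; rewrite (ord1 j) colmulE.
transitivity (
  \sum_a \sum_b scal (col_mx (coord (qonb a * qonb b)) 0 i 0) *
    (x1 a 0 * y1 b 0) +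
  \sum_a \sum_b scal (col_mx 0 (coord (qonb a * qonb b)) i 0) *
    (x2 a 0 * y2 b 0)).
  rewrite sumr_add; congr (_ + _); apply: eq_bigr => a _.
    rewrite sumr_add [E in _ + E]big1 ?addr0 => [|b _]; last first.
      by rewrite lr mxE rmorph0 mul0r.
    by apply: eq_bigr => b _; rewrite ll !col_mxEu.
  rewrite sumr_add [E in E + _]big1 ?add0r => [|b _]; last first.
    by rewrite rl mxE rmorph0 mul0r.
  by apply: eq_bigr => b _; rewrite rr !col_mxEd.
case: (split_ordP i) => k ->.
  rewrite col_mxEu colmulE [E in _ + E]big1 ?addr0 => [|a _]; last first.
    by rewrite big1 // => b _; rewrite col_mxEu mxE rmorph0 mul0r.
  by apply: eq_bigr => a _; apply: eq_bigr => b _; rewrite col_mxEu.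
rewrite col_mxEd colmulE [E in E + _]big1 ?add0r => [|a _]; last first.
  by rewrite big1 // => b _; rewrite col_mxEd mxE rmorph0 mul0r.
by apply: eq_bigr => a _; apply: eq_bigr => b _; rewrite col_mxEd.
Qed.

Lemma coact_qsum (u : 'M[A]_n1) v w (z : 'M[A]_n2) (x : qfun Y) :
  coact (X := Y) (block_mx u v w z) x =
  col_mx (coact u x.1 + v *m L (coord x.2)) (w *m L (coord x.1) + coact z x.2).
Proof. by rewrite /coact liftmx_coord_qsum mul_block_col. Qed.

End DisjointUnion.

Section DisjointUnionMult.
Variables (C : numClosedFieldType) (X1 X2 : qspace C) (A : starAlgType C).
Local Notation n1 := (qdim X1).
Local Notation n2 := (qdim X2).
Local Notation L := (liftmx A).
Local Notation Y := (qsum X1 X2).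

Lemma unitary_block_diag (w1 : 'M[A]_n1) (w2 : 'M[A]_n2) :
  unitary (block_mx w1 0 0 w2) <-> unitary w1 /\ unitary w2.
Proof.
rewrite /unitary starmx_block !mulmx_block !starmx0.
rewrite !(mulmx0, mul0mx, addr0, add0r) scalar_mx_block.
by split=> [[/eq_block_mx[-> _ _ ->] /eq_block_mx[-> _ _ ->]]|[[-> ->] [-> ->]]].
Qed.

Lemma coact_block_diag (w1 : 'M[A]_n1) (w2 : 'M[A]_n2) (x : qfun Y) :
  coact (X := Y) (block_mx w1 0 0 w2) x = col_mx (coact w1 x.1) (coact w2 x.2).
Proof. by rewrite coact_qsum !mul0mx addr0 add0r. Qed.

Lemma multiplicative_block_diag (w1 : 'M[A]_n1) (w2 : 'M[A]_n2) :
  multiplicative_mx (X := Y) (block_mx w1 0 0 w2) <->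
  multiplicative_mx w1 /\ multiplicative_mx w2.
Proof.
split=> [/intertwine_multP h|[/intertwine_multP h1 /intertwine_multP h2]].
  split; apply/intertwine_multP => x y.
    have := h ((x, 0) : qfun Y) ((y, 0) : qfun Y).
    by rewrite !coact_block_diag colmul_qsum => /eq_col_mx[].
  have := h ((0, x) : qfun Y) ((0, y) : qfun Y).
  by rewrite !coact_block_diag colmul_qsum => /eq_col_mx[].
by apply/intertwine_multP => x y; rewrite !coact_block_diag colmul_qsum -h1 -h2.
Qed.

(** The indicator of either half is a projection fixed by w, so by
    multiplicativity w commutes with multiplication by it, that is, with the
    projection onto that half. *)
Lemma multiplicative_fix_block_diag (w : 'M[A]_(n1 + n2)) :
  multiplicative_mx (X := Y) w ->
  w *m col_mx (L (qeta X1)) 0 = col_mx (L (qeta X1)) 0 ->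
  w *m col_mx 0 (L (qeta X2)) = col_mx 0 (L (qeta X2)) ->
  w = block_mx (ulsubmx w) 0 0 (drsubmx w).
Proof.
move=> /intertwine_multP mw f1 f2; rewrite -[LHS]submxK.
have e1 : coact (X := Y) w ((1, 0) : qfun Y) = col_mx (L (qeta X1)) 0.
  by rewrite /coact liftmx_coord_qsum /= coord0 /liftmx map_mx0 -coord1 f1.
have e2 : coact (X := Y) w ((0, 1) : qfun Y) = col_mx 0 (L (qeta X2)).
  by rewrite /coact liftmx_coord_qsum /= coord0 /liftmx map_mx0 -coord1 f2.
congr block_mx.
  apply/matrixP => i j.
  have := mw ((0, 1) : qfun Y) ((0, qonb j) : qfun Y).
  rewrite e2 -(submxK w) !coact_qsum colmul_qsum /= mul1r mulr0 colmul0l.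
  move=> /eq_col_mx[+ _].
  rewrite submxK /coact coord0 /liftmx map_mx0 mulmx0 add0r mulmx_onb.
  by move/matrixP/(_ i 0); rewrite !mxE.
apply/matrixP => i j.
have := mw ((1, 0) : qfun Y) ((qonb j, 0) : qfun Y).
rewrite e1 -(submxK w) !coact_qsum colmul_qsum /= mul1r mulr0 colmul0l.
move=> /eq_col_mx[_ +].
rewrite submxK /coact coord0 /liftmx map_mx0 mulmx0 addr0 mulmx_onb.
by move/matrixP/(_ i 0); rewrite !mxE.
Qed.

End DisjointUnionMult.

Section Doubling.
Variables (C : numClosedFieldType) (X : qspace C) (A : starAlgType C).
Local Notation n := (qdim X).
Local Notation L := (liftmx A).
Local Notation XX := (qsum X X).
Implicit Types (u a : 'M[A]_n).

(** C(X) (+) C(X) is graded over the group of order two: a product of two odd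
    elements is even. The hypotheses are multiplicativity in each degree. *)
Lemma multiplicative_evodd a u :
  (forall x y, colmul (coact u x) (coact u y) = coact a (x * y)) ->
  (forall x y, colmul (coact a x) (coact u y) = coact u (x * y)) ->
  (forall x y, colmul (coact u x) (coact a y) = coact u (x * y)) ->
  (forall x y, colmul (coact a x) (coact a y) = coact a (x * y)) ->
  multiplicative_mx (X := XX) (evodd a u).
Proof.
move=> uu au ua aa; apply/intertwine_multP => x y; rewrite /evodd.
set P := _ *: (a + u); set M := _ *: (a - u).
have PP z t : colmul (coact P z) (coact P t) = coact P (z * t).
  rewrite /P !coactZl !coactDl colmulZl colmulZr colmulDl !colmulDr uu au ua aa.
  by rewrite [coact u _ + coact a _]addrC halfmxK.
have PM z t : colmul (coact P z) (coact M t) = 0.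
  rewrite /P /M !coactZl !coactDl coactNl colmulZl colmulZr colmulDl.
  rewrite !colmulDr !colmulNr uu au ua aa.
  by rewrite addrC addrA subrK subrr !scaler0.
have MP z t : colmul (coact M z) (coact P t) = 0.
  rewrite /P /M !coactZl !coactDl coactNl colmulZl colmulZr colmulDl.
  rewrite !colmulDr !colmulNl uu au ua aa.
  by rewrite -opprD [coact u _ + coact a _]addrC subrr !scaler0.
have MM z t : colmul (coact M z) (coact M t) = coact M (z * t).
  rewrite /M !coactZl !coactDl !coactNl colmulZl colmulZr colmulDl.
  rewrite !colmulDr !(colmulNl, colmulNr) opprK.
  by rewrite uu au ua aa [- coact u _ + coact a _]addrC halfmxK.
rewrite !coact_qsum -!/(coact _ _) colmul_qsum !colmulDl !colmulDr.
by rewrite !PP !PM !MP !MM !addr0 !add0r.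
Qed.

Lemma multiplicative_evodd_odd a u : multiplicative_mx (X := XX) (evodd a u) ->
  forall x y, colmul (coact u x) (coact u y) = coact a (x * y).
Proof.
have odd x : coact (X := XX) (evodd a u) ((x, - x) : qfun XX) =
    col_mx (coact u x) (- coact u x).
  rewrite coact_qsum /= -!/(coact _ _) !coactN -[in RHS](half_odd a u).
  by rewrite coactDl coactNl opprB.
have even x : coact (X := XX) (evodd a u) ((x, x) : qfun XX) =
    col_mx (coact a x) (coact a x).
  rewrite coact_qsum /= -!/(coact _ _) -!coactDl half_even.
  by rewrite [_ *: (a - u) + _]addrC half_even.
move=> /intertwine_multP h x y.
have := h ((x, - x) : qfun XX) ((y, - y) : qfun XX).
rewrite !odd colmul_qsum -[_ * _]/((x * y, - x * - y) : qfun XX).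
by rewrite mulrNN even => /eq_col_mx[].
Qed.

Lemma evodd_eta a u : evodd a u *m col_mx (L (qeta X)) (L (qeta X)) =
  col_mx (a *m L (qeta X)) (a *m L (qeta X)).
Proof.
rewrite mul_block_col -!mulmxDl half_even.
by rewrite [_ *: (a - u) + _]addrC half_even.
Qed.

End Doubling.

Lemma block_diag_commute (R : pzRingType) m (P Q D B B' : 'M[R]_m) :
  block_mx P 0 0 Q *m block_mx D B B' 0 = block_mx D B B' 0 *m block_mx P 0 0 Q <->
  [/\ P *m D = D *m P, P *m B = B *m Q & Q *m B' = B' *m P].
Proof.
rewrite !mulmx_block !(mulmx0, mul0mx, addr0, add0r).
by split=> [/eq_block_mx[]|[-> -> ->]].
Qed.

(** * Automorphisms of the Hadamard graphs *)

Section HadamardGraph.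
Variables (C : numClosedFieldType) (X : qspace C).
Local Notation n := (qdim X).
Local Notation XX := (qsum X X).
Variables (H : 'M[C]_n) (hH : qhadamard H).

Section Coefficients.
Variable A : starAlgType C.
Local Notation L := (liftmx A).
Implicit Types (q a u : 'M[A]_n).

(** The automorphism of two copies of X defined by a cubic u: the Schur square
    of u on even vectors, u itself on odd ones. *)
Definition double_rep u : 'M[A]_(n + n) := evodd (schurA u u) u.

(** The matrix [hgraph_action], for an arbitrary matrix q in place of the
    generator of O(Aut H). *)
Definition had_action q : 'M[A]_(qdim (qsum4 X)) :=
  block_mx (double_rep (hconj H q)) 0 0 (double_rep q).

Lemma qJ_adj : (qJ X)^t* = qJ X.
Proof. by rewrite /qJ trmx_mul map_mxM /= trmxCK. Qed.

Lemma qJ_eta : qJ X *m qeta X = qdelta2 X *: qeta X.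
Proof.
by rewrite /qJ -mulmxA [_ *m qeta X]mx11_scalar mul_mx_scalar.
Qed.

Lemma qJ_sqr : qJ X *m qJ X = qdelta2 X *: qJ X.
Proof. by rewrite {2}/qJ mulmxA qJ_eta -scalemxAl. Qed.

Lemma half_adj (M : 'M[C]_n) : (2^-1 *: M)^t* = 2^-1 *: M^t*.
Proof.
have h : (2^-1 : C)^* = 2^-1 by rewrite geC0_conj // invr_ge0 ler0n.
by apply/matrixP => i j; rewrite !mxE rmorphM /= h.
Qed.

(** The block (H+, H-; H-, H+) is J on even vectors and H on odd ones. *)
Lemma liftmx_offdiag :
  L (hgraph_offdiag H) = evodd (L (qJ X)) (L H).
Proof.
rewrite /liftmx /hgraph_offdiag map_block_mx /Hplus /Hminus !map_mxZ.
by rewrite map_mxB map_mxD.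
Qed.

Lemma liftmx_offdiag_adj :
  L (hgraph_offdiag_adj H) = evodd (L (qJ X)) (L (H^t*)).
Proof.
rewrite /liftmx /hgraph_offdiag_adj map_block_mx /Hplus /Hminus !half_adj !map_mxZ.
by rewrite !linearB !linearD /= !map_mxB !map_mxD qJ_adj.
Qed.

Lemma liftmx_hgraph : L (hgraph H) =
  block_mx 0 (evodd (L (qJ X)) (L H)) (evodd (L (qJ X)) (L (H^t*))) 0
  :> 'M_(n + n + (n + n)).
Proof.
rewrite -liftmx_offdiag -liftmx_offdiag_adj.
by rewrite /liftmx map_block_mx !block_mx0 map_mx0.
Qed.

Lemma liftmx_hgraph0 : L (hgraph0 H) =
  block_mx 1%:M (evodd (L (qJ X)) (L H)) (evodd (L (qJ X)) (L (H^t*))) 0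
  :> 'M_(n + n + (n + n)).
Proof.
rewrite -liftmx_offdiag -liftmx_offdiag_adj.
by rewrite /liftmx map_block_mx !block_mx0 map_mx0 -scalar_mx_block map_mx1.
Qed.

Lemma hconjE u v : hconj H u = v <-> v *m L H = L H *m u.
Proof.
have Hu := qhadamard_unit hH.
have HV : L H *m L (invmx H) = 1%:M by rewrite -liftmxM mulmxV // liftmx1.
have VH : L (invmx H) *m L H = 1%:M by rewrite -liftmxM mulVmx // liftmx1.
split=> [<-|e]; first by rewrite /hconj -mulmxA VH mulmx1.
by rewrite /hconj -e -mulmxA HV mulmx1.
Qed.

Lemma qhad_inv : H^t* = qdelta2 X *: invmx H.
Proof.
have Hu := qhadamard_unit hH; have [_ _ hHH _] := hH.
by rewrite -mul_mx_scalar -hHH mulmxA mulVmx // mul1mx.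
Qed.

(** The adjoint of H is a multiple of its inverse, and this is conjugation by
    that inverse. *)
Lemma hconj_adj u : L (H^t*) *m hconj H u = u *m L (H^t*).
Proof.
have VH : L (invmx H) *m L H = 1%:M.
  by rewrite -liftmxM mulVmx ?qhadamard_unit // liftmx1.
rewrite qhad_inv liftmxZ scale_mulmx -scalemxAl; congr (_ *: _).
by rewrite /hconj !mulmxA VH mul1mx.
Qed.

Lemma liftmx_eta_qsum :
  L (qeta XX) = col_mx (L (qeta X)) (L (qeta X)) :> 'cV_(n + n).
Proof. exact: (liftmx_coord_qsum A (1 : qfun XX)). Qed.

Lemma liftmx_eta4 :
  L (qeta (qsum4 X)) = col_mx (L (qeta XX)) (L (qeta XX)) :> 'cV_(n + n + (n + n)).
Proof. exact: (liftmx_coord_qsum A (1 : qfun (qsum4 X))). Qed.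

Lemma double_rep_unitary u : cubic u -> unitary (double_rep u).
Proof.
move=> cu; apply/unitary_evodd; split; first exact: cubic_schur_unitary.
by case: cu.
Qed.

Lemma double_rep_mult u : cubic u -> multiplicative_mx (X := XX) (double_rep u).
Proof. by move=> /cubic_graded[uu au ua aa]; apply: multiplicative_evodd. Qed.

Lemma double_rep_eta u : cubic u -> double_rep u *m L (qeta XX) = L (qeta XX).
Proof. by move=> cu; rewrite liftmx_eta_qsum evodd_eta cubic_eta. Qed.

Lemma schur_J u : cubic u ->
  schurA u u *m L (qJ X) = L (qJ X) /\ L (qJ X) *m schurA u u = L (qJ X).
Proof.
move=> cu; rewrite /qJ liftmxM -starmx_lift; split.
  by rewrite mulmxA cubic_eta.
rewrite -mulmxA unitary_fixl //; first exact: cubic_schur_unitary.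
exact: cubic_eta.
Qed.

(** The diagonal block D distinguishes the two graphs: D = 0 for the first one
    and D = 1 for the second one. What remains of commutation with the adjacency
    matrix is, on even vectors, invariance of the unit and, on odd vectors,
    p H = H q. *)
Lemma had_action_graph_rel q T (D : 'M[A]_(n + n)) : had_rel H q ->
  L T = block_mx D (evodd (L (qJ X)) (L H)) (evodd (L (qJ X)) (L (H^t*))) 0
    :> 'M_(n + n + (n + n)) ->
  (forall w : 'M_(n + n), w *m D = D *m w) ->
  graph_rel (X := qsum4 X) T (had_action q).
Proof.
move=> [cq cp] hT hD.
have uw : unitary (had_action q).
  by apply/unitary_block_diag; split; apply: double_rep_unitary.
split=> //.
- by apply/multiplicative_block_diag; split; apply: double_rep_mult.
- rewrite -starmx_lift unitary_fixl // liftmx_eta4 mul_block_col !mul0mx.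
  by rewrite addr0 add0r !double_rep_eta.
rewrite hT; apply/block_diag_commute; rewrite /double_rep !evodd_mul hconj_adj.
have [-> ->] := schur_J cq; have [-> ->] := schur_J cp.
by have /hconjE-> := erefl (hconj H q).
Qed.

(** Recovers q from the second diagonal block (q+, q-; q-, q+) as q+ - q-. *)
Definition odd_part (w : 'M[A]_(qdim (qsum4 X))) : 'M[A]_n :=
  let w2 := drsubmx (w : 'M_(n + n + (n + n))) in ulsubmx w2 - ursubmx w2.

Lemma odd_part_had_action q : odd_part (had_action q) = q.
Proof. by rewrite /odd_part block_mxKdr block_mxKul block_mxKur half_odd. Qed.

(** J on the even vectors is a multiple of the projection onto the line of 1. *)
Lemma evodd_J : evodd (L (qJ X)) 0 =
  scal 2^-1 *: (L (qeta XX) *m starmx (L (qeta XX))).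
Proof.
rewrite liftmx_eta_qsum /evodd addr0 subr0 /starmx tr_col_mx map_row_mx.
by rewrite -!/(starmx _) mul_col_row scale_block_mx starmx_lift -liftmxM.
Qed.

(** The matrix with which w commutes is delta^2 times (J on even vectors, 1 on odd
    ones). Its even part commutes with w already because w fixes the unit, so w
    commutes with the projection onto the odd vectors. *)
Lemma evodd_of_commute (w : 'M[A]_(n + n)) :
  unitary w -> w *m L (qeta XX) = L (qeta XX) ->
  w *m evodd (L (qJ X *m qJ X)) (L (qdelta2 X)%:M) =
    evodd (L (qJ X *m qJ X)) (L (qdelta2 X)%:M) *m w ->
  w = evodd (ulsubmx w + ursubmx w) (ulsubmx w - ursubmx w).
Proof.
(* delta^2 vanishes only for the empty space, where all matrices coincide *)
move=> uw we; case: (posnP n) => [n0 _|/qdelta2_neq0 d0].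
  apply/matrixP => i; have := ltn_ord i; rewrite [X in (_ < X)%N](_ : _ = 0%N) //.
  by rewrite n0.
have J0 : w *m evodd (L (qJ X)) 0 = evodd (L (qJ X)) 0 *m w.
  rewrite evodd_J scale_mulmx mulmxA we -scalemxAl -mulmxA.
  by rewrite (unitary_fixl uw we).
rewrite qJ_sqr -scalemx1 !liftmxZ liftmx1.
rewrite evodd_scale scale_mulmx -scalemxAl.
move/(congr1 (fun M => scal (qdelta2 X)^-1 *: M)).
rewrite !scalerA -rmorphM mulVf // rmorph1 !scale1r => h.
apply: evodd_commute; move: h; rewrite evodd_split mulmxDl mulmxDr J0.
exact: addrI.
Qed.

(** On odd vectors (x, -x)(y, -y) = (xy, xy), so multiplicativity of w gives
    u(x) u(y) = a(xy), from which a is the Schur square of u. *)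
Lemma evodd_cubic a u (w := evodd a u) : unitary w ->
  multiplicative_mx (X := XX) w -> w *m L (qeta XX) = L (qeta XX) ->
  cubic u /\ w = double_rep u.
Proof.
move=> /unitary_evodd[ua uu] /multiplicative_evodd_odd h.
rewrite liftmx_eta_qsum evodd_eta => /eq_col_mx[ea _].
have [cu e] := cubic_of_graded uu ua ea h.
by rewrite /w /double_rep e.
Qed.

(** From 1 and A_0 1 one obtains the indicator of the first half of Y, which makes
    w block diagonal with blocks P and Q. These intertwine the off-diagonal
    blocks B and B' of A_0, hence P commutes with B B' and Q with B' B, both equal
    to delta^2 (J on even vectors, 1 on odd ones); so P and Q preserve parity.
    The odd components of P and Q are then cubic, and P B = B Q on odd vectors
    says that H conjugates one to the other. *)
Lemma graph_rel_had_action (w : 'M[A]_(qdim (qsum4 X))) :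
  graph_rel (X := qsum4 X) (hgraph0 H) w ->
  had_rel H (odd_part w) /\ w = had_action (odd_part w).
Proof.
case=> uw mw ew; rewrite liftmx_hgraph0.
set B := evodd _ (L H); set B' := evodd _ (L _) => cw.
have weta : w *m L (qeta (qsum4 X)) = L (qeta (qsum4 X)).
  by apply: unitary_fixr; rewrite // starmx_lift.
pose e := L (qeta XX).
pose d := scal (qdelta2 X) : A.
have Je M : evodd (L (qJ X)) M *m e = d *: e.
  rewrite /e liftmx_eta_qsum evodd_eta -liftmxM qJ_eta liftmxZ.
  by rewrite scale_col_mx.
have Be : B *m e = d *: e by apply: Je.
have B'e : B' *m e = d *: e by apply: Je.
(* A_0 1 = (1 + delta^2, delta^2), so subtracting delta^2 leaves the top half *)
have top : (col_mx e 0 : 'cV_(n + n + (n + n))) =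
    block_mx 1%:M B B' 0 *m L (qeta (qsum4 X)) - d *: L (qeta (qsum4 X)).
  rewrite liftmx_eta4 mul_block_col -/e Be B'e mul1mx mul0mx addr0.
  by rewrite scale_col_mx opp_col_mx add_col_mx addrK subrr.
have f1 : w *m (col_mx e 0 : 'cV_(n + n + (n + n))) = col_mx e 0.
  by rewrite top mulmxBr scale_mulmx weta mulmxA cw -mulmxA weta.
have f2 : w *m (col_mx 0 e : 'cV_(n + n + (n + n))) = col_mx 0 e.
  have -> : (col_mx 0 e : 'cV_(n + n + (n + n))) =
      L (qeta (qsum4 X)) - (col_mx e 0 : 'cV_(n + n + (n + n))).
    by rewrite liftmx_eta4 opp_col_mx add_col_mx subrr oppr0 addr0.
  by rewrite mulmxBr weta f1.
have := multiplicative_fix_block_diag mw f1 f2.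
rewrite /odd_part; set P := ulsubmx _; set Q := drsubmx _ => wE.
move: uw mw cw f1 f2; rewrite wE => /unitary_block_diag[uP uQ].
move=> /multiplicative_block_diag[mP mQ].
case/block_diag_commute => _ PB QB'.
rewrite !mul_block_col !(mulmx0, mul0mx, addr0, add0r).
move=> /eq_col_mx[Pe _] /eq_col_mx[_ Qe].
have [_ _ HH1 HH2] := hH.
have PE : P = evodd (ulsubmx P + ursubmx P) (ulsubmx P - ursubmx P).
  apply: evodd_of_commute => //; rewrite -HH1.
  rewrite (liftmxM A (qJ X)) (liftmxM A H) -evodd_mul -/B -/B'.
  by rewrite mulmxA PB -[LHS]mulmxA QB' mulmxA.
have QE : Q = evodd (ulsubmx Q + ursubmx Q) (ulsubmx Q - ursubmx Q).
  apply: evodd_of_commute => //; rewrite -HH2.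
  rewrite (liftmxM A (qJ X)) (liftmxM A (H^t*)) -evodd_mul -/B -/B'.
  by rewrite mulmxA QB' -[LHS]mulmxA PB mulmxA.
set p := ulsubmx P - _ in PE; set q := ulsubmx Q - _ in QE *.
move: uP uQ mP mQ Pe Qe PB; rewrite PE QE => uP uQ mP mQ Pe Qe.
have [cp ->] := evodd_cubic uP mP Pe; have [cq ->] := evodd_cubic uQ mQ Qe.
rewrite !evodd_mul => /evodd_inj[_ /hconjE pq].
by rewrite /had_action /had_rel pq.
Qed.

End Coefficients.

End HadamardGraph.

(** * The isomorphism of quantum groups *)

Section TensorHom.
Variables (C : numClosedFieldType) (A A' B B' : starAlgType C).
Variables (f : starHom A A') (g : starHom B B').

Lemma tenshom_tensl x : tenshom f g (tensl B x) = tensl B' (f x).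
Proof. exact: uev_ugen. Qed.

Lemma tenshom_tensr y : tenshom f g (tensr A y) = tensr A' (g y).
Proof. exact: uev_ugen. Qed.
End TensorHom.

Section QuantumGroup.
Variables (C : numClosedFieldType) (X : qspace C).
Local Notation n := (qdim X).

Lemma map_schurA (A B : starAlgType C) (f : starHom A B) (u v : 'M[A]_n) :
  map_mx f (schurA u v) = schurA (map_mx f u) (map_mx f v).
Proof. by rewrite /schurA !map_mxM !map_liftmx map_mxT. Qed.

Lemma map_had_action H (A B : starAlgType C) (f : starHom A B) (q : 'M[A]_n) :
  map_mx f (had_action H q) = had_action H (map_mx f q).
Proof.
rewrite /had_action /double_rep map_block_mx !map_mx0 !map_evodd !map_schurA.
by rewrite -!hconj_hom.
Qed.

Lemma map_odd_part (A B : starAlgType C) (f : starHom A B)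
    (w : 'M[A]_(qdim (qsum4 X))) :
  map_mx f (odd_part w) = odd_part (map_mx f w).
Proof. by rewrite /odd_part map_mxB -map_drsubmx -map_ulsubmx -map_ursubmx. Qed.

HB.instance Definition _ (A : starAlgType C) :=
  RMorphism_isStarMorphism.Build C A A idfun (fun=> erefl) (fun=> erefl).

Section Products.
Variables (A : starAlgType C).

(** Here m^dagger intertwines the Schur square of v with v (x) v, so that the
    second factor can be pulled out. *)
Lemma schurA_mul (u v : 'M[A]_n) :
  (forall i j k l, GRing.comm (u i j) (v k l)) -> cubic v ->
  schurA (u *m v) (u *m v) = schurA u u *m schurA v v.
Proof.
move=> uv cv; rewrite [in RHS]/schurA -mulmxA cubic_comult // /schurA.
by rewrite tensmx_mul_comm // !mulmxA.
Qed.

Lemma double_rep_mul (u v : 'M[A]_n) :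
  (forall i j k l, GRing.comm (u i j) (v k l)) -> cubic v ->
  double_rep (u *m v) = double_rep u *m double_rep v.
Proof. by move=> uv cv; rewrite /double_rep evodd_mul schurA_mul. Qed.

Lemma hconj_comm H (u v : 'M[A]_n) :
  (forall i j k l, GRing.comm (u i j) (v k l)) ->
  forall i j k l, GRing.comm (hconj H u i j) (hconj H v k l).
Proof.
have half (a b : 'M[A]_n) : (forall i j k l, GRing.comm (a i j) (b k l)) ->
    forall i j k l, GRing.comm (hconj H a i j) (b k l).
  move=> ab; apply: mulmx_comm; last exact: liftmx_comm.
  by apply: mulmx_comm => //; apply: liftmx_comm.
move=> uv; apply: (half) => i j k l.
apply: commr_sym; apply: half => *; apply: commr_sym; apply: uv.
Qed.

Lemma had_action_mul (H : 'M[C]_n) (u v : 'M[A]_n) : H \in unitmx ->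
  (forall i j k l, GRing.comm (u i j) (v k l)) -> had_rel H v ->
  had_action H (u *m v) = had_action H u *m had_action H v.
Proof.
move=> Hu uv [cv cp]; rewrite /had_action mulmx_block.
rewrite !(mulmx0, mul0mx, addr0, add0r).
by rewrite hconjM // (double_rep_mul uv cv) (double_rep_mul (hconj_comm H uv) cp).
Qed.
End Products.

Variables (H : 'M[C]_n) (hH : qhadamard H).
Local Notation G := (AutG (hgraph0 H)).
Local Notation K := (AutH hH).

Lemma AutH_rel : had_rel H (AutH_rep hH).
Proof. exact: had_rel_gen. Qed.

Lemma AutH_graph_rel (A : starAlgType C) (q : 'M[A]_n) : had_rel H q ->
  graph_rel (hgraph H) (had_action H q) /\ graph_rel (hgraph0 H) (had_action H q).
Proof.
move=> hq; split.
  apply: (had_action_graph_rel hH hq (liftmx_hgraph H A)) => w.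
  by rewrite mulmx0 mul0mx.
apply: (had_action_graph_rel hH hq (liftmx_hgraph0 H A)) => w.
by rewrite mulmx1 mul1mx.
Qed.

Lemma hgraph_actionE : hgraph_action hH = had_action H (AutH_rep hH).
Proof. by []. Qed.

Lemma hgraph_action_corep : corep (hgraph_action hH).
Proof.
rewrite /corep hgraph_actionE !map_had_action.
have -> : map_mx (comult K) (AutH_rep hH) =
    map_mx (@tensl C K K) (AutH_rep hH) *m map_mx (@tensr C K K) (AutH_rep hH).
  exact: mxqgroup_corep.
apply: had_action_mul; first exact: qhadamard_unit.
  by move=> i j k l; rewrite !mxE; apply: tens_comm.
by apply: had_rel_hom; apply: AutH_rel.
Qed.

Definition graph_to_had : starHom G K :=
  mxlift (AutH_graph_rel AutH_rel).2.

Definition had_to_graph : starHom K G :=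
  mxlift (graph_rel_had_action hH (graph_rel_gen (hgraph0 H))).1.

Lemma graph_to_hadE :
  map_mx graph_to_had (AutG_rep (hgraph0 H)) = hgraph_action hH.
Proof. exact: mxliftE. Qed.

Lemma had_to_graphE :
  map_mx had_to_graph (AutH_rep hH) = odd_part (AutG_rep (hgraph0 H)).
Proof. exact: mxliftE. Qed.

(** Star-homomorphisms on a universal algebra are determined by the images of
    the generating matrix; this reduces identities between such maps to
    identities between matrices. *)
Lemma mxalg_hom_ext m (P : forall B : starAlgType C, 'M[B]_m -> Prop)
  (B : starAlgType C) (f g : starHom (mxalg P) B) :
  map_mx f (mxgen P) = map_mx g (mxgen P) -> f =1 g.
Proof.
move=> h; apply: ualg_hom_ext => -[i j].
by move/matrixP/(_ i j): h; rewrite !mxE.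
Qed.

Lemma graph_to_hadK : cancel graph_to_had had_to_graph.
Proof.
apply: (@mxalg_hom_ext _ _ _ (had_to_graph \o graph_to_had) idfun).
rewrite map_mx_comp map_mx_id // -/(AutG_rep (hgraph0 H)) graph_to_hadE.
rewrite hgraph_actionE map_had_action had_to_graphE.
by rewrite -(graph_rel_had_action hH (graph_rel_gen (hgraph0 H))).2.
Qed.

Lemma had_to_graphK : cancel had_to_graph graph_to_had.
Proof.
apply: (@mxalg_hom_ext _ _ _ (graph_to_had \o had_to_graph) idfun).
rewrite map_mx_comp map_mx_id // -/(AutH_rep hH) had_to_graphE.
by rewrite map_odd_part graph_to_hadE hgraph_actionE odd_part_had_action.
Qed.

Lemma graph_to_had_comult (x : G) :
  comult K (graph_to_had x) = tenshom graph_to_had graph_to_had (comult G x).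
Proof.
move: x; apply: (@mxalg_hom_ext _ _ _ (comult K \o graph_to_had)
  (tenshom graph_to_had graph_to_had \o comult G)).
rewrite [LHS]map_mx_comp [RHS]map_mx_comp -/(AutG_rep (hgraph0 H)).
rewrite graph_to_hadE hgraph_action_corep.
have -> : map_mx (comult G) (AutG_rep (hgraph0 H)) =
    map_mx (@tensl C G G) (AutG_rep (hgraph0 H)) *m
    map_mx (@tensr C G G) (AutG_rep (hgraph0 H)).
  exact: mxqgroup_corep.
rewrite map_mxM -graph_to_hadE; congr (_ *m _); apply/matrixP => i j; rewrite !mxE.
  by apply: (esym (tenshom_tensl graph_to_had graph_to_had _)).
by apply: (esym (tenshom_tensr graph_to_had graph_to_had _)).
Qed.

End QuantumGroup.

Theorem proposition6p11 (R : realType) (X : qspace R[i])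
    (H : 'M[R[i]]_(qdim X)) (hH : qhadamard H) :
  [/\ acts (hgraph H) (hgraph_action hH),
      acts (hgraph0 H) (hgraph_action hH)
    & exists f : starHom (AutG (hgraph0 H)) (AutH hH),
        qgroup_iso f /\ map_mx f (AutG_rep (hgraph0 H)) = hgraph_action hH].
Proof.
have [h h0] := AutH_graph_rel hH (AutH_rel hH).
have hc := hgraph_action_corep hH.
split=> //; exists (graph_to_had hH); split; last exact: graph_to_hadE.
split; last exact: graph_to_had_comult.
by exists (had_to_graph hH); [exact: graph_to_hadK|exact: had_to_graphK].
Qed.
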